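(* Let $L/K$ be a field extension of odd degree with $\mathrm{char}\,K\neq 2$, and let $\epsilon=\pm1$. Let $(\mathscr{C},*,\omega)$ be a pseudo-abelian $K$-linear hermitian category such that $\dim_K\mathrm{Hom}(M,M')$ is finite for all $M,M'\in\mathscr{C}$. Then the maps $$W^{\epsilon}(\mathscr{C})\to W^{\epsilon}(\mathscr{C}_L^\circ)\qquad\text{and}\qquad W_S(\mathscr{C})\to W_S(\mathscr{C}_L^\circ)$$ induced by the scalar extension functor $\mathcal{R}_{L/K}$ (i.e. by $(M,s)\mapsto(M_L,s_L)$) are injective.
   Context: A hermitian category is a triple $(\mathscr{C},*,\omega)$ with $\mathscr{C}$ additive, $*:\mathscr{C}\to\mathscr{C}$ an (additive) contravariant functor and $\omega:\mathrm{id}\to **$ a natural transformation (not necessarily an isomorphism) with $\omega_C^*\,\omega_{C^*}=\mathrm{id}_{C^*}$ for all $C$. An object $C$ is reflexive if $\omega_C$ is an isomorphism. The hermitian category is $K$-linear if $\mathscr{C}$ is a $K$-category (Hom-sets are $K$-modules, composition $K$-bilinear) and $*$ is $K$-linear. A sesquilinear form over $\mathscr{C}$ is a pair $(C,s)$ with $s:C\to C^*$. It is unimodular if $s$ and $s^*\omega_C$ are isomorphisms, $\epsilon$-hermitian if $s=\epsilon s^*\omega_C$. An isometry $(C,s)\to(C',s')$ is an isomorphism $f:C\to C'$ with $s=f^*s'f$. Orthogonal sums are direct sums of forms. $W^\epsilon(\mathscr{C})$ is the quotient of the Grothendieck group (with respect to orthogonal sum) of isometry classes of unimodular $\epsilon$-hermitian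 forms over $\mathscr{C}$ by the subgroup generated by the forms isometric to $\left(Q\oplus Q^*,\begin{bmatrix}0&\mathrm{id}_{Q^*}\\ \epsilon\omega_Q&0\end{bmatrix}\right)$, $Q$ a reflexive object (the hyperbolic forms). Write $W=W^1$. Twisted double arrows: $\widetilde{\mathrm{Ar}}_{2}(\mathscr{C})$ has objects $(M,N,f,g)$ with $f,g\in\mathrm{Hom}_{\mathscr{C}}(M,N^* )$; morphisms $(M,N,f,g)\to(M',N',f',g')$ are pairs $(\phi,\psi^{\mathrm{op}})$ with $\phi\in\mathrm{Hom}(M,M')$, $\psi\in\mathrm{Hom}(N',N)$, $f'\phi=\psi^*f$, $g'\phi=\psi^*g$; composition $(\phi,\psi^{\mathrm{op}})(\phi',\psi'^{\mathrm{op}})=(\phi\phi',(\psi'\psi)^{\mathrm{op}})$. It is a hermitian category via $(M,N,f,g)^*=(N,M,g^*\omega_N,f^*\omega_N)$, $(\phi,\psi^{\mathrm{op}})^*=(\psi,\phi^{\mathrm{op}})$, $\omega=\mathrm{id}$. A sesquilinear form $(M,s)$ over $\mathscr{C}$ is called hyperbolic if the unimodular $1$-hermitian form $F(M,s)=((M,M,s^*\omega_M,s),(\mathrm{id}_M,\mathrm{id}_M^{\mathrm{op}}))$ over $\widetilde{\mathrm{Ar}}_{2}(\mathscr{C})$ is hyperbolic. $W_S(\mathscr{C})$ is the quotient of the Grothendieck group of isometry classes of all sesquilinear forms over $\mathscr{C}$ (with respect to orthogonal sum) by the subgroup generated by the hyperbolic sesquilinear forms. Scalar extension: $\mathscr{C}_L=\mathscr{C}\otimes_K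 L$ has objects formal symbols $C_L$ ($C\in\mathscr{C}$), $\mathrm{Hom}_{\mathscr{C}_L}(A_L,B_L)=\mathrm{Hom}_{\mathscr{C}}(A,B)\otimes_KL$, obvious composition, and hermitian structure $(C_L)^*=(C^* )_L$, $(f\otimes a)^*=f^*\otimes a$, $\omega_{C_L}=\omega_C\otimes1$. For $(M,s)$ over $\mathscr{C}$, $\mathcal{R}_{L/K}(M,s)=(M_L,s_L)$ with $s_L=s\otimes1$. An additive category is pseudo-abelian if every idempotent endomorphism $e\in\mathrm{End}(M)$ splits, i.e. there are $i:M'\to M$, $j:M\to M'$ with $ji=\mathrm{id}_{M'}$, $ij=e$. The pseudo-abelian closure $\mathscr{D}^\circ$ of an additive category $\mathscr{D}$ has objects the pairs $(M,e)$ with $M\in\mathscr{D}$ and $e\in\mathrm{End}(M)$ idempotent, and $\mathrm{Hom}((M,e),(M',e'))=e'\,\mathrm{Hom}_{\mathscr{D}}(M,M')\,e$; $\mathscr{D}$ is identified with the full subcategory of objects $(M,\mathrm{id}_M)$. If $\mathscr{D}$ is a hermitian category, so is $\mathscr{D}^\circ$, with $(M,e)^*=(M^*,e^* )$ and $\omega_{(M,e)}=e^{**}\omega_Me$. $\mathscr{C}_L^\circ$ denotes $(\mathscr{C}_L)^\circ$. *)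

(* Defs.v *)
From HB Require Import structures.
From mathcomp Require Import all_boot all_order all_algebra all_field.
From mathcomp Require Import boolp.
From mathcomp Require Import freeg.

Set Implicit Arguments.
Unset Strict Implicit.
Unset Printing Implicit Defensive.
Import GRing.Theory.
Local Open Scope ring_scope.
Local Open Scope quotient_scope.

Inductive subgroup_gen (G : zmodType) (S : G -> Prop) : G -> Prop :=
| SubgroupGen0 : subgroup_gen S 0
| SubgroupGenBase x : S x -> subgroup_gen S x
| SubgroupGenB x y :
    subgroup_gen S x -> subgroup_gen S y -> subgroup_gen S (x - y).

Definition subgroup_pred (G : zmodType) (S : G -> Prop) : G -> bool :=
  fun x => `[< subgroup_gen S x >].

Section SubgroupGen.
Variables (G : zmodType) (S : G -> Prop).

Fact subgroup_pred_closed : zmod_closed (subgroup_pred S).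
Proof.
split; first by apply/asboolP; constructor.
by move=> x y /asboolP Sx /asboolP Sy; apply/asboolP; constructor.
Qed.
HB.instance Definition _ := GRing.isZmodClosed.Build G (subgroup_pred S)
  subgroup_pred_closed.

Definition subgroup : zmodClosed G :=
  GRing.ZmodClosed.clone G (subgroup_pred S) _.
Definition quotg : Type := Quotient.quot subgroup.
HB.instance Definition _ := GRing.Zmodule.on quotg.
HB.instance Definition _ := Quotient.on quotg.

Definition qclass (x : G) : quotg := \pi_quotg x.

Fact qclass_is_zmod_morphism : zmod_morphism qclass.
Proof. exact: (@pi_is_zmod_morphism _ _ _ (Quotient.quot subgroup)). Qed.
HB.instance Definition _ := GRing.isZmodMorphism.Build G quotg qclass
  qclass_is_zmod_morphism.

Lemma qclassK (x : quotg) : qclass (repr x) = x.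
Proof. exact: reprK. Qed.

Lemma qclass_eq x y : qclass x = qclass y <-> subgroup_gen S (x - y).
Proof.
split.
  move/eqP; rewrite /qclass => h.
  by apply/asboolP; move: h; rewrite -Quotient.idealrBE.
by move=> h; apply/eqP; rewrite /qclass -Quotient.idealrBE; apply/asboolP.
Qed.

Lemma qclass_eq0 x : S x -> qclass x = 0.
Proof.
by move=> Sx; rewrite -(raddf0 qclass); apply/qclass_eq; rewrite subr0; constructor.
Qed.

(* The homomorphism induced by [f]; meaningful when [f] is additive and       *)
(* vanishes on [S].                                                           *)
Definition quotg_lift (H : zmodType) (f : G -> H) (x : quotg) : H := f (repr x).

Lemma quotg_liftE (H : zmodType) (f : {additive G -> H}) :
  (forall x, S x -> f x = 0) -> forall x, quotg_lift f (qclass x) = f x.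
Proof.
move=> fS x; apply/eqP; rewrite -subr_eq0 -raddfB; apply/eqP.
have: subgroup_gen S (repr (qclass x) - x) by apply/qclass_eq; rewrite qclassK.
elim=> [|y /fS //|y z _ fy _ fz]; first by rewrite raddf0.
by rewrite raddfB fy fz subrr.
Qed.

End SubgroupGen.
Arguments qclass {G} S.

Section FreeGroup.
Variables (T : choiceType) (H : zmodType).

Definition free_lift (f : T -> H) (D : {freeg T}) : H :=
  fglift (f : T -> zmodule H) D.

Fact free_lift_is_zmod_morphism f : zmod_morphism (free_lift f).
Proof. exact: (lift_is_additive (M := zmodule H)). Qed.
HB.instance Definition _ f := GRing.isZmodMorphism.Build {freeg T} H
  (free_lift f) (free_lift_is_zmod_morphism f).

Lemma free_liftE f x : free_lift f << x >> = f x.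
Proof. by rewrite /free_lift liftU scale1r. Qed.

Lemma freeg_gen_ind (P : {freeg T} -> Prop) :
  P 0 -> (forall x, P << x >>) -> (forall D E, P D -> P E -> P (D - E)) ->
  forall D, P D.
Proof.
move=> P0 P1 PB.
have PN D : P D -> P (- D) by move=> PD; rewrite -[- D]add0r; apply: PB.
have PD D E : P D -> P E -> P (D + E).
  by move=> ? ?; rewrite -[E]opprK; apply: PB => //; apply: PN.
have Pn n x : P << n%:Z *g x >>.
  elim: n => [|n IHn]; first by rewrite freegU0.
  by rewrite -addn1 PoszD -freegUD; apply: PD.
elim/freeg_ind_dom0 => // k x D _ _ PD'; apply: PD => //.
by case: k => n; rewrite ?NegzE -?freegUN; try apply: PN; apply: Pn.
Qed.

End FreeGroup.

Section Tensor.
Variables (K : comNzRingType) (V W : lmodType K).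

Inductive tensor_rel : {freeg (V * W)%type} -> Prop :=
| TensorDl v v' w :
    tensor_rel (<< (v + v', w) >> - << (v, w) >> - << (v', w) >>)
| TensorDr v w w' :
    tensor_rel (<< (v, w + w') >> - << (v, w) >> - << (v, w') >>)
| TensorZ a v w : tensor_rel (<< (a *: v, w) >> - << (v, a *: w) >>).

Definition tensor : Type := quotg tensor_rel.
HB.instance Definition _ := GRing.Zmodule.on tensor.

Definition tens (v : V) (w : W) : tensor := qclass tensor_rel << (v, w) >>.

Definition tensor_lift (H : zmodType) (h : V -> W -> H) : tensor -> H :=
  quotg_lift (free_lift (fun p : V * W => h p.1 p.2)).

Definition balanced (H : zmodType) (h : V -> W -> H) :=
  [/\ forall w, {morph h^~ w : v v' / v + v'},
      forall v, {morph h v : w w' / w + w'} &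
      forall a v w, h (a *: v) w = h v (a *: w)].

Lemma tensor_ind (P : tensor -> Prop) :
  (forall v w, P (tens v w)) -> (forall x y, P x -> P y -> P (x - y)) ->
  forall x, P x.
Proof.
move=> P1 PB x; rewrite -(qclassK x); elim/freeg_gen_ind: (repr x).
- by rewrite raddf0 -(subrr (tens 0 0)); apply: PB.
- by case=> v w; apply: P1.
- by move=> D E PD PE; rewrite raddfB; apply: PB.
Qed.

Lemma tensDl v v' w : tens (v + v') w = tens v w + tens v' w.
Proof.
apply/eqP; rewrite -subr_eq0 opprD addrA /tens -!raddfB; apply/eqP.
exact/qclass_eq0/TensorDl.
Qed.

Lemma tensDr v w w' : tens v (w + w') = tens v w + tens v w'.
Proof.
apply/eqP; rewrite -subr_eq0 opprD addrA /tens -!raddfB; apply/eqP.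
exact/qclass_eq0/TensorDr.
Qed.

Lemma tensZ a v w : tens (a *: v) w = tens v (a *: w).
Proof.
apply/eqP; rewrite -subr_eq0 /tens -!raddfB; apply/eqP.
exact/qclass_eq0/TensorZ.
Qed.

Lemma tens0l w : tens 0 w = 0.
Proof. by apply: (addrI (tens 0 w)); rewrite -tensDl !addr0. Qed.

Lemma balanced_tens : balanced tens.
Proof.
by split=> [w v v'|v w w'|a v w]; rewrite (tensDl, tensDr, tensZ).
Qed.

Section Lift.
Variables (H : zmodType) (h : V -> W -> H).
Hypothesis hB : balanced h.

Lemma tensor_lift_rel z :
  tensor_rel z -> free_lift (fun p : V * W => h p.1 p.2) z = 0.
Proof.
case: hB => hl hr hz.
by case=> *; rewrite !raddfB /= !free_liftE /= ?hl ?hr ?hz ?opprD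
  ?subrr // addrAC addrK subrr.
Qed.

Lemma tensor_liftE v w : tensor_lift h (tens v w) = h v w.
Proof.
rewrite /tensor_lift quotg_liftE; first exact: free_liftE.
exact: tensor_lift_rel.
Qed.

Lemma tensor_liftB x y : tensor_lift h (x - y) = tensor_lift h x - tensor_lift h y.
Proof.
rewrite -(qclassK x) -(qclassK y) -raddfB /tensor_lift.
by rewrite !quotg_liftE ?raddfB; do ?exact: tensor_lift_rel.
Qed.

End Lift.
End Tensor.

Section Witt.
Variables (T : Type) (iso : T -> T -> Prop) (op : T -> T -> T) (H : T -> Prop).

(* The Grothendieck group of the monoid of [iso]-classes of [T] under [op],   *)
(* presented by one generator for each element of [T].                        *)
Inductive groth_rel : {freeg {classic T}} -> Prop :=
| GrothIso (x y : {classic T}) : iso x y -> groth_rel (<< x >> - << y >>)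
| GrothOp (x y : {classic T}) :
    groth_rel (<< (op x y : {classic T}) >> - << x >> - << y >>).

Definition groth : Type := quotg groth_rel.
HB.instance Definition _ := GRing.Zmodule.on groth.

Definition groth_class (x : T) : groth := qclass groth_rel << (x : {classic T}) >>.

Inductive witt_rel : groth -> Prop :=
| WittRel x : H x -> witt_rel (groth_class x).

Definition witt : Type := quotg witt_rel.
HB.instance Definition _ := GRing.Zmodule.on witt.

Definition witt_class (x : T) : witt := qclass witt_rel (groth_class x).

Lemma witt_class_iso x y : iso x y -> witt_class x = witt_class y.
Proof.
move=> xy; congr qclass; apply/eqP; rewrite -subr_eq0 -raddfB; apply/eqP.
exact/qclass_eq0/GrothIso.
Qed.

Lemma witt_class_op x y : witt_class (op x y) = witt_class x + witt_class y.
Proof.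
rewrite -[RHS]raddfD; congr qclass; apply/eqP.
rewrite -subr_eq0 opprD addrA -!raddfB; apply/eqP.
exact/qclass_eq0/GrothOp.
Qed.

Lemma witt_class_eq0 x : H x -> witt_class x = 0.
Proof. by move=> Hx; apply/qclass_eq0/WittRel. Qed.

Lemma witt_ind (P : witt -> Prop) :
  P 0 -> (forall x, P (witt_class x)) ->
  (forall x y, P x -> P y -> P (x - y)) -> forall x, P x.
Proof.
move=> P0 P1 PB x; rewrite -(qclassK x) -(qclassK (repr x)).
elim/freeg_gen_ind: (repr (repr x)).
- by rewrite !raddf0.
- by move=> y; apply: P1.
- by move=> D E PD PE; rewrite !raddfB; apply: PB.
Qed.

(* The homomorphism sending the class of [x] to [f x]; meaningful when [f]    *)
(* respects [iso], [op] and [H], see [witt_liftE].                            *)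
Definition witt_lift (G : zmodType) (f : T -> G) : witt -> G :=
  quotg_lift (quotg_lift (free_lift (f : {classic T} -> G))).

Section Lift.
Variables (G : zmodType) (f : T -> G).
Hypotheses (f_iso : forall x y, iso x y -> f x = f y)
  (f_op : forall x y, f (op x y) = f x + f y) (fH : forall x, H x -> f x = 0).

Let g : groth -> G := quotg_lift (free_lift (f : {classic T} -> G)).

Let g_rel z : groth_rel z -> free_lift (f : {classic T} -> G) z = 0.
Proof.
case=> x y => [xy|]; rewrite !raddfB /= !free_liftE.
  by rewrite (f_iso xy) subrr.
by rewrite f_op addrAC addrK subrr.
Qed.

Let gB : zmod_morphism g.
Proof.
move=> x y; rewrite -(qclassK x) -(qclassK y) -raddfB /g.
by rewrite !quotg_liftE ?raddfB; do ?exact: g_rel.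
Qed.
HB.instance Definition _ := GRing.isZmodMorphism.Build groth G g gB.

Let g_class x : g (groth_class x) = f x.
Proof. by rewrite /g quotg_liftE; [exact: free_liftE | exact: g_rel]. Qed.

Let g_witt z : witt_rel z -> g z = 0.
Proof. by case=> x /fH; rewrite g_class. Qed.

Lemma witt_liftE x : witt_lift f (witt_class x) = f x.
Proof. by rewrite /witt_lift -/g quotg_liftE; [exact: g_class | exact: g_witt]. Qed.

Lemma witt_liftB : zmod_morphism (witt_lift f).
Proof.
move=> x y; rewrite -(qclassK x) -(qclassK y) -raddfB /witt_lift -/g.
by rewrite !quotg_liftE ?raddfB; do ?exact: g_witt.
Qed.

End Lift.
End Witt.

Record addCat := AddCat {
  obj :> Type;
  hom : obj -> obj -> zmodType;
  idc : forall A, hom A A;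
  comp : forall A B C, hom B C -> hom A B -> hom A C;
  comp1c : forall A B (f : hom A B), comp (idc B) f = f;
  compc1 : forall A B (f : hom A B), comp f (idc A) = f;
  compA : forall A B C D (h : hom C D) (g : hom B C) (f : hom A B),
    comp h (comp g f) = comp (comp h g) f;
  compDl : forall A B C (g g' : hom B C) (f : hom A B),
    comp (g + g') f = comp g f + comp g' f;
  compDr : forall A B C (g : hom B C) (f f' : hom A B),
    comp g (f + f') = comp g f + comp g f';
  zob : obj;
  idc_zob : idc zob = 0;
  bip : obj -> obj -> obj;
  injl : forall A B, hom A (bip A B);
  injr : forall A B, hom B (bip A B);
  prjl : forall A B, hom (bip A B) A;
  prjr : forall A B, hom (bip A B) B;
  prjl_injl : forall A B, comp (prjl A B) (injl A B) = idc A;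
  prjr_injr : forall A B, comp (prjr A B) (injr A B) = idc B;
  prjl_injr : forall A B, comp (prjl A B) (injr A B) = 0;
  prjr_injl : forall A B, comp (prjr A B) (injl A B) = 0;
  bip_id : forall A B,
    comp (injl A B) (prjl A B) + comp (injr A B) (prjr A B) = idc (bip A B)
}.

Arguments idc {_} A.
Arguments injl {_ A B}.
Arguments injr {_ A B}.
Arguments prjl {_ A B}.
Arguments prjr {_ A B}.

Reserved Notation "g \oc f" (at level 40, left associativity).
Notation "g \oc f" := (comp g f) : ring_scope.

Section AddCatTheory.
Variable D : addCat.
Implicit Types A B C : D.

Lemma comp0c A B C (f : hom A B) : (0 : hom B C) \oc f = 0.
Proof. by apply: (addrI (0 \oc f)); rewrite -compDl !addr0. Qed.

Lemma compc0 A B C (g : hom B C) : g \oc (0 : hom A B) = 0.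
Proof. by apply: (addrI (g \oc 0)); rewrite -compDr !addr0. Qed.

Lemma compNl A B C (g : hom B C) (f : hom A B) : (- g) \oc f = - (g \oc f).
Proof. by apply: (addrI (g \oc f)); rewrite -compDl !subrr comp0c. Qed.

Lemma compNr A B C (g : hom B C) (f : hom A B) : g \oc (- f) = - (g \oc f).
Proof. by apply: (addrI (g \oc f)); rewrite -compDr !subrr compc0. Qed.

Lemma compBl A B C (g g' : hom B C) (f : hom A B) :
  (g - g') \oc f = g \oc f - g' \oc f.
Proof. by rewrite compDl compNl. Qed.

Lemma compBr A B C (g : hom B C) (f f' : hom A B) :
  g \oc (f - f') = g \oc f - g \oc f'.
Proof. by rewrite compDr compNr. Qed.

Lemma compMnl A B C (g : hom B C) (f : hom A B) n :
  (g *+ n) \oc f = (g \oc f) *+ n.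
Proof. by elim: n => [|n IHn]; rewrite ?mulr0n ?comp0c // !mulrS compDl IHn. Qed.

Lemma compMnr A B C (g : hom B C) (f : hom A B) n :
  g \oc (f *+ n) = (g \oc f) *+ n.
Proof. by elim: n => [|n IHn]; rewrite ?mulr0n ?compc0 // !mulrS compDr IHn. Qed.

Lemma compMzl A B C (g : hom B C) (f : hom A B) (n : int) :
  (g *~ n) \oc f = (g \oc f) *~ n.
Proof. by case: n => n; rewrite ?NegzE -?nmulrn ?compNl -?pmulrn compMnl. Qed.

Lemma compMzr A B C (g : hom B C) (f : hom A B) (n : int) :
  g \oc (f *~ n) = (g \oc f) *~ n.
Proof. by case: n => n; rewrite ?NegzE -?nmulrn ?compNr -?pmulrn compMnr. Qed.

Definition is_iso A B (f : hom A B) :=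
  exists g : hom B A, g \oc f = idc A /\ f \oc g = idc B.

Lemma is_iso1 A : is_iso (idc A).
Proof. by exists (idc A); rewrite comp1c. Qed.

Lemma is_iso_comp A B C (g : hom B C) (f : hom A B) :
  is_iso g -> is_iso f -> is_iso (g \oc f).
Proof.
case=> g' [g'g gg'] [f' [f'f ff']]; exists (f' \oc g'); split.
  by rewrite -compA (compA g') g'g comp1c.
by rewrite -compA (compA f) ff' comp1c.
Qed.

End AddCatTheory.

Definition pseudo_abelian (C : addCat) :=
  forall (M : C) (e : hom M M), e \oc e = e ->
  exists (M' : C) (i : hom M' M) (j : hom M M'), j \oc i = idc M' /\ i \oc j = e.

Record hermCat := HermCat {
  hcat :> addCat;
  dual : hcat -> hcat;
  star : forall A B : hcat, hom A B -> hom (dual B) (dual A);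
  starD : forall A B (f g : @hom hcat A B), star (f + g) = star f + star g;
  star1 : forall A : hcat, star (idc A) = idc (dual A);
  starM : forall A B C (g : @hom hcat B C) (f : hom A B),
    star (g \oc f) = star f \oc star g;
  omega : forall A : hcat, hom A (dual (dual A));
  omega_nat : forall A B (f : @hom hcat A B),
    omega B \oc f = star (star f) \oc omega A;
  omega_dual : forall A : hcat, star (omega A) \oc omega (dual A) = idc (dual A)
}.

Record sesq (C : hermCat) := Sesq { sob :> C; smor : hom sob (dual sob) }.

Section Forms.
Variable C : hermCat.
Implicit Types (A B M Q : C) (x y : sesq C).

Lemma star0 A B : star (0 : hom A B) = 0.
Proof. by apply: (addrI (star (0 : hom A B))); rewrite -starD !addr0. Qed.

Lemma starN A B (f : hom A B) : star (- f) = - star f.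
Proof. by apply: (addrI (star f)); rewrite -starD !subrr star0. Qed.

Lemma starB A B (f g : hom A B) : star (f - g) = star f - star g.
Proof. by rewrite starD starN. Qed.

Definition reflexive_ob A := is_iso (omega A).

Definition isometric x y :=
  exists f : hom (sob x) (sob y),
    is_iso f /\ smor x = star f \oc smor y \oc f.

Definition unimodular x := is_iso (smor x) /\ is_iso (star (smor x) \oc omega x).

Definition eherm (eps : int) x := smor x = (star (smor x) \oc omega x) *~ eps.

(* The direct sum of [f] and [g], under the identification of the dual of     *)
(* [bip A' B'] with [bip (dual A') (dual B')].                                *)
Definition dsum A B A' B' (f : hom A (dual A')) (g : hom B (dual B')) :
  hom (bip A B) (dual (bip A' B')) :=
  star prjl \oc f \oc prjl + star prjr \oc g \oc prjr.

Definition orth x y : sesq C := @Sesq C (bip x y) (dsum (smor x) (smor y)).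

(* Under the same identification, this is the matrix [0, 1; eps omega, 0].    *)
Definition hyp_form (eps : int) Q : sesq C :=
  @Sesq C (bip Q (dual Q))
    (star prjl \oc idc (dual Q) \oc prjr
     + star prjr \oc (omega Q *~ eps) \oc prjl).

Definition hyperbolic (eps : int) x :=
  exists Q, reflexive_ob Q /\ isometric x (hyp_form eps Q).

Lemma isometric_trans x y z : isometric x y -> isometric y z -> isometric x z.
Proof.
case=> f [fi fE] [g [gi gE]]; exists (g \oc f); split; first exact: is_iso_comp.
by rewrite fE gE starM !compA.
Qed.

Lemma is_iso_star A B (f : hom A B) : is_iso f -> is_iso (star f).
Proof.
by case=> g [gf fg]; exists (star g); rewrite -!starM gf fg !star1.
Qed.

Lemma star_prjl_injl A B :
  star (@injl C A B) \oc star prjl = idc (dual A).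
Proof. by rewrite -starM prjl_injl star1. Qed.

Lemma star_prjr_injr A B :
  star (@injr C A B) \oc star prjr = idc (dual B).
Proof. by rewrite -starM prjr_injr star1. Qed.

Lemma star_prjl_injr A B : star (@injr C A B) \oc star prjl = 0.
Proof. by rewrite -starM prjl_injr star0. Qed.

Lemma star_prjr_injl A B : star (@injl C A B) \oc star prjr = 0.
Proof. by rewrite -starM prjr_injl star0. Qed.

Lemma dsum_injl A B A' B' (f : hom A (dual A')) (g : hom B (dual B')) :
  dsum f g \oc injl = star prjl \oc f.
Proof.
by rewrite /dsum compDl -!compA prjl_injl prjr_injl !compc0 compc1 addr0.
Qed.

Lemma dsum_injr A B A' B' (f : hom A (dual A')) (g : hom B (dual B')) :
  dsum f g \oc injr = star prjr \oc g.
Proof.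
by rewrite /dsum compDl -!compA prjr_injr prjl_injr !compc0 compc1 add0r.
Qed.

Lemma dsum_prjl A B A' B' (f : hom A (dual A')) (g : hom B (dual B')) :
  f \oc prjl = star (injl : hom _ (bip A' B')) \oc dsum f g.
Proof.
by rewrite /dsum compDr !compA star_prjl_injl star_prjr_injl !comp0c comp1c addr0.
Qed.

Lemma dsum_prjr A B A' B' (f : hom A (dual A')) (g : hom B (dual B')) :
  g \oc prjr = star (injr : hom _ (bip A' B')) \oc dsum f g.
Proof.
by rewrite /dsum compDr !compA star_prjl_injr star_prjr_injr !comp0c comp1c add0r.
Qed.

Lemma is_iso_dsum A B (f : hom A (dual A)) (g : hom B (dual B)) :
  is_iso f -> is_iso g ->
  is_iso (dsum f g).
Proof.
rewrite /dsum; case=> f' [f'f ff'] [g' [g'g gg']].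
exists (injl \oc f' \oc star injl + injr \oc g' \oc star injr); split.
- rewrite !compDl !compDr !compA.
  rewrite -!(compA _ (star injl)) -!(compA _ (star injr)).
  rewrite star_prjl_injl star_prjr_injr star_prjl_injr star_prjr_injl.
  rewrite !compc0 !comp0c !compc1 addr0 add0r -!(compA injl) -!(compA injr).
  by rewrite f'f g'g !comp1c bip_id.
- rewrite !compDl !compDr !compA.
  rewrite -!(compA _ prjl) -!(compA _ prjr).
  rewrite prjl_injl prjr_injr prjl_injr prjr_injl.
  rewrite !compc0 !comp0c !compc1 addr0 add0r -!(compA (star prjl)).
  rewrite -!(compA (star prjr)) ff' gg' !comp1c.
  by rewrite -!starM -starD bip_id star1.
Qed.

Lemma orth_adj x y : star (smor (orth x y)) \oc omega (orth x y) =
  dsum (star (smor x) \oc omega x) (star (smor y) \oc omega y).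
Proof.
rewrite /= /dsum starD !starM compDl -!compA; congr (_ + _).
  by rewrite -omega_nat.
by rewrite -omega_nat.
Qed.

Lemma orth_unimodular x y : unimodular x -> unimodular y -> unimodular (orth x y).
Proof.
case=> [xl xr] [yl yr]; split; first exact: is_iso_dsum.
by rewrite orth_adj; apply: is_iso_dsum.
Qed.

Lemma orth_eherm eps x y : eherm eps x -> eherm eps y -> eherm eps (orth x y).
Proof.
move=> xE yE; rewrite /eherm orth_adj /= /dsum {1}xE {1}yE.
by rewrite !compMzr !compMzl -mulrzDl.
Qed.

Record uform (eps : int) := UForm {
  uform_sesq :> sesq C;
  uformU : unimodular uform_sesq;
  uformE : eherm eps uform_sesq
}.

Definition uorth eps (x y : uform eps) : uform eps :=
  UForm (orth_unimodular (uformU x) (uformU y))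
        (orth_eherm (uformE x) (uformE y)).

Definition uisometric eps (x y : uform eps) := isometric x y.
Definition uhyperbolic eps (x : uform eps) := hyperbolic eps x.

End Forms.

Definition W (eps : int) (C : hermCat) : zmodType :=
  witt (@uisometric C eps) (@uorth C eps) (@uhyperbolic C eps).

Definition Wclass (eps : int) (C : hermCat) (x : uform C eps) : W eps C :=
  witt_class (@uisometric C eps) (@uorth C eps) (@uhyperbolic C eps) x.

Section TwistedArrows.
Variable C : hermCat.

Record ar2_ob := Ar2Ob {
  ar2M : C;
  ar2N : C;
  ar2f : hom ar2M (dual ar2N);
  ar2g : hom ar2M (dual ar2N)
}.
Implicit Types X Y Z : ar2_ob.

(* The second component [psi] of a morphism points backwards.                 *)
Definition ar2_pred X Y : hom (ar2M X) (ar2M Y) * hom (ar2N Y) (ar2N X) -> bool :=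
  fun p => (ar2f Y \oc p.1 == star p.2 \oc ar2f X) &&
           (ar2g Y \oc p.1 == star p.2 \oc ar2g X).

Fact ar2_pred_closed X Y : zmod_closed (@ar2_pred X Y).
Proof.
split; first by rewrite unfold_in /= star0 !compc0 !comp0c !eqxx.
move=> p q; rewrite !unfold_in /= => /andP[/eqP pf /eqP pg] /andP[/eqP qf /eqP qg].
by rewrite !starB !compBr !compBl pf pg qf qg !eqxx.
Qed.
HB.instance Definition _ X Y :=
  GRing.isZmodClosed.Build _ (@ar2_pred X Y) (@ar2_pred_closed X Y).

Definition ar2_hom X Y : Type := {p | p \in @ar2_pred X Y}.
HB.instance Definition _ X Y := [isSub of ar2_hom X Y for @sval _ _].
HB.instance Definition _ X Y := [Choice of ar2_hom X Y by <:].
HB.instance Definition _ X Y := [SubChoice_isSubZmodule of ar2_hom X Y by <:].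

Lemma ar2_predP X Y (p : hom (ar2M X) (ar2M Y) * hom (ar2N Y) (ar2N X)) :
  ar2f Y \oc p.1 = star p.2 \oc ar2f X -> ar2g Y \oc p.1 = star p.2 \oc ar2g X ->
  p \in @ar2_pred X Y.
Proof. by move=> pf pg; apply/andP; split; apply/eqP. Qed.

Definition ar2_mor X Y (phi : hom (ar2M X) (ar2M Y)) (psi : hom (ar2N Y) (ar2N X))
    (hf : ar2f Y \oc phi = star psi \oc ar2f X)
    (hg : ar2g Y \oc phi = star psi \oc ar2g X) : ar2_hom X Y :=
  exist _ (phi, psi) (@ar2_predP X Y (phi, psi) hf hg).

Definition ar2_phi X Y (p : ar2_hom X Y) : hom (ar2M X) (ar2M Y) := (val p).1.
Definition ar2_psi X Y (p : ar2_hom X Y) : hom (ar2N Y) (ar2N X) := (val p).2.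

Lemma ar2_homf X Y (p : ar2_hom X Y) :
  ar2f Y \oc ar2_phi p = star (ar2_psi p) \oc ar2f X.
Proof. by have /andP[/eqP] := valP p. Qed.

Lemma ar2_homg X Y (p : ar2_hom X Y) :
  ar2g Y \oc ar2_phi p = star (ar2_psi p) \oc ar2g X.
Proof. by have /andP[_ /eqP] := valP p. Qed.

Lemma ar2_homP X Y (p q : ar2_hom X Y) :
  ar2_phi p = ar2_phi q -> ar2_psi p = ar2_psi q -> p = q.
Proof.
rewrite /ar2_phi /ar2_psi => h1 h2; apply: val_inj.
by move: h1 h2; case: (val p) (val q) => [? ?] [? ?] /= -> ->.
Qed.

Fact ar2_idf X : ar2f X \oc idc (ar2M X) = star (idc (ar2N X)) \oc ar2f X.
Proof. by rewrite star1 comp1c compc1. Qed.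
Fact ar2_idg X : ar2g X \oc idc (ar2M X) = star (idc (ar2N X)) \oc ar2g X.
Proof. by rewrite star1 comp1c compc1. Qed.
Definition ar2_id X : ar2_hom X X := ar2_mor (ar2_idf X) (ar2_idg X).

Fact ar2_compf X Y Z (q : ar2_hom Y Z) (p : ar2_hom X Y) :
  ar2f Z \oc (ar2_phi q \oc ar2_phi p) =
  star (ar2_psi p \oc ar2_psi q) \oc ar2f X.
Proof. by rewrite starM compA ar2_homf -!compA ar2_homf. Qed.
Fact ar2_compg X Y Z (q : ar2_hom Y Z) (p : ar2_hom X Y) :
  ar2g Z \oc (ar2_phi q \oc ar2_phi p) =
  star (ar2_psi p \oc ar2_psi q) \oc ar2g X.
Proof. by rewrite starM compA ar2_homg -!compA ar2_homg. Qed.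
Definition ar2_comp X Y Z (q : ar2_hom Y Z) (p : ar2_hom X Y) : ar2_hom X Z :=
  ar2_mor (ar2_compf q p) (ar2_compg q p).

Definition ar2_zob : ar2_ob := @Ar2Ob (zob C) (zob C) 0 0.

Definition ar2_bip X Y : ar2_ob :=
  @Ar2Ob (bip (ar2M X) (ar2M Y)) (bip (ar2N X) (ar2N Y))
    (dsum (ar2f X) (ar2f Y)) (dsum (ar2g X) (ar2g Y)).

Definition ar2_injl X Y : ar2_hom X (ar2_bip X Y) :=
  @ar2_mor X (ar2_bip X Y) injl prjl
    (dsum_injl (ar2f X) (ar2f Y)) (dsum_injl (ar2g X) (ar2g Y)).
Definition ar2_injr X Y : ar2_hom Y (ar2_bip X Y) :=
  @ar2_mor Y (ar2_bip X Y) injr prjr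
    (dsum_injr (ar2f X) (ar2f Y)) (dsum_injr (ar2g X) (ar2g Y)).
Definition ar2_prjl X Y : ar2_hom (ar2_bip X Y) X :=
  @ar2_mor (ar2_bip X Y) X prjl injl
    (dsum_prjl (ar2f X) (ar2f Y)) (dsum_prjl (ar2g X) (ar2g Y)).
Definition ar2_prjr X Y : ar2_hom (ar2_bip X Y) Y :=
  @ar2_mor (ar2_bip X Y) Y prjr injr
    (dsum_prjr (ar2f X) (ar2f Y)) (dsum_prjr (ar2g X) (ar2g Y)).

Definition ar2_addCat : addCat.
Proof.
refine (@AddCat ar2_ob (fun X Y => (ar2_hom X Y : zmodType)) ar2_id ar2_comp
  _ _ _ _ _ ar2_zob _ ar2_bip ar2_injl ar2_injr ar2_prjl ar2_prjr _ _ _ _ _).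
- by move=> X Y f; apply: ar2_homP; [apply: comp1c | apply: compc1].
- by move=> X Y f; apply: ar2_homP; [apply: compc1 | apply: comp1c].
- by move=> X Y Z T h g f; apply: ar2_homP; [apply: compA | apply/esym/compA].
- by move=> X Y Z g g' f; apply: ar2_homP; [apply: compDl | apply: compDr].
- by move=> X Y Z g f f'; apply: ar2_homP; [apply: compDr | apply: compDl].
- by apply: ar2_homP; apply: idc_zob.
- by move=> X Y; apply: ar2_homP; apply: prjl_injl.
- by move=> X Y; apply: ar2_homP; apply: prjr_injr.
- by move=> X Y; apply: ar2_homP; [apply: prjl_injr | apply: prjr_injl].
- by move=> X Y; apply: ar2_homP; [apply: prjr_injl | apply: prjl_injr].
- by move=> X Y; apply: ar2_homP; apply: bip_id.
Defined.

Definition ar2_dual X : ar2_ob :=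
  @Ar2Ob (ar2N X) (ar2M X)
    (star (ar2g X) \oc omega (ar2N X)) (star (ar2f X) \oc omega (ar2N X)).

Fact ar2_starf X Y (p : ar2_hom X Y) :
  ar2f (ar2_dual X) \oc ar2_psi p = star (ar2_phi p) \oc ar2f (ar2_dual Y).
Proof. by rewrite /= compA -starM ar2_homg starM -!compA omega_nat. Qed.
Fact ar2_starg X Y (p : ar2_hom X Y) :
  ar2g (ar2_dual X) \oc ar2_psi p = star (ar2_phi p) \oc ar2g (ar2_dual Y).
Proof. by rewrite /= compA -starM ar2_homf starM -!compA omega_nat. Qed.
Definition ar2_star X Y (p : ar2_hom X Y) : ar2_hom (ar2_dual Y) (ar2_dual X) :=
  @ar2_mor (ar2_dual Y) (ar2_dual X) (ar2_psi p) (ar2_phi p)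
    (ar2_starf p) (ar2_starg p).

Lemma star_omega_star (A B : C) (f : hom A (dual B)) :
  star (star f \oc omega B) \oc omega A = f.
Proof. by rewrite starM -compA -omega_nat compA omega_dual comp1c. Qed.

(* [X] and its double dual are equal, but not convertible; [omega] has        *)
(* identities as components.                                                  *)
Fact ar2_omegaf X :
  ar2f (ar2_dual (ar2_dual X)) \oc idc (ar2M X) = star (idc (ar2N X)) \oc ar2f X.
Proof. by rewrite /= star_omega_star star1 comp1c compc1. Qed.
Fact ar2_omegag X :
  ar2g (ar2_dual (ar2_dual X)) \oc idc (ar2M X) = star (idc (ar2N X)) \oc ar2g X.
Proof. by rewrite /= star_omega_star star1 comp1c compc1. Qed.
Definition ar2_omega X : ar2_hom X (ar2_dual (ar2_dual X)) :=
  @ar2_mor X (ar2_dual (ar2_dual X)) (idc (ar2M X)) (idc (ar2N X))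
    (ar2_omegaf X) (ar2_omegag X).

Definition Ar2 : hermCat.
Proof.
refine (@HermCat ar2_addCat ar2_dual ar2_star _ _ _ ar2_omega _ _).
- by move=> X Y f g; apply: ar2_homP.
- by move=> X; apply: ar2_homP.
- by move=> X Y Z g f; apply: ar2_homP.
- by move=> X Y f; apply: ar2_homP; rewrite /ar2_phi /ar2_psi /= comp1c compc1.
- by move=> X; apply: ar2_homP; rewrite /ar2_phi /ar2_psi /= comp1c.
Defined.

Fact ar2_formf (x : sesq C) :
  ar2f (ar2_dual (Ar2Ob (star (smor x) \oc omega x) (smor x))) \oc idc x =
  star (idc x) \oc (star (smor x) \oc omega x).
Proof. by rewrite /= star1 comp1c compc1. Qed.
Fact ar2_formg (x : sesq C) :
  ar2g (ar2_dual (Ar2Ob (star (smor x) \oc omega x) (smor x))) \oc idc x =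
  star (idc x) \oc smor x.
Proof. by rewrite /= star_omega_star star1 comp1c compc1. Qed.

(* The unimodular 1-hermitian form [F(M,s)] for [x = (M,s)].                  *)
Definition ar2_form (x : sesq C) : sesq Ar2 :=
  let X : Ar2 := Ar2Ob (star (smor x) \oc omega x) (smor x) in
  @Sesq Ar2 X (@ar2_mor X (ar2_dual X) (idc x) (idc x) (ar2_formf x) (ar2_formg x)).

End TwistedArrows.

Definition sesq_hyperbolic (C : hermCat) (x : sesq C) := hyperbolic 1 (ar2_form x).

Definition WS (C : hermCat) : zmodType :=
  witt (@isometric C) (@orth C) (@sesq_hyperbolic C).

Definition WSclass (C : hermCat) (x : sesq C) : WS C :=
  witt_class (@isometric C) (@orth C) (@sesq_hyperbolic C) x.

Record hermFunctor (C D : hermCat) := HermFunctor {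
  hfob :> C -> D;
  hfhom : forall A B : C, hom A B -> hom (hfob A) (hfob B);
  hfD : forall A B (f g : @hom C A B), hfhom (f + g) = hfhom f + hfhom g;
  hf1 : forall A, hfhom (idc A) = idc (hfob A);
  hfM : forall A B A' (g : @hom C B A') (f : hom A B),
    hfhom (g \oc f) = hfhom g \oc hfhom f;
  hfdelta : forall A, hom (hfob (dual A)) (dual (hfob A));
  hfdelta_iso : forall A, is_iso (hfdelta A);
  hfdelta_nat : forall A B (f : @hom C A B),
    hfdelta A \oc hfhom (star f) = star (hfhom f) \oc hfdelta B;
  hfdelta_omega : forall A,
    hfdelta (dual A) \oc hfhom (omega A) = star (hfdelta A) \oc omega (hfob A)
}.

Definition hf_comp (C D E : hermCat) (G : hermFunctor D E) (F : hermFunctor C D) :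
  hermFunctor C E.
Proof.
refine (@HermFunctor C E (G \o F) (fun A B f => hfhom G (hfhom F f)) _ _ _
  (fun A => hfdelta G (F A) \oc hfhom G (hfdelta F A)) _ _ _).
- by move=> A B f g; rewrite !hfD.
- by move=> A; rewrite !hf1.
- by move=> A B A' g f; rewrite !hfM.
- move=> A; apply: is_iso_comp; first exact: hfdelta_iso.
  have [g [gf fg]] := hfdelta_iso F A.
  by exists (hfhom G g); rewrite -!hfM gf fg !hf1.
- move=> A B f.
  by rewrite -compA -hfM hfdelta_nat hfM compA hfdelta_nat -compA.
- move=> A /=.
  rewrite -compA -hfM hfdelta_omega hfM compA hfdelta_nat -compA hfdelta_omega.
  by rewrite starM compA.
Defined.

Section HermFunctor.
Variables (C D : hermCat) (F : hermFunctor C D).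
Implicit Types (A B Q : C) (x y : sesq C).

Lemma hf0 A B : hfhom F (0 : hom A B) = 0.
Proof. by apply: (addrI (hfhom F (0 : hom A B))); rewrite -hfD !addr0. Qed.

Lemma hfN A B (f : hom A B) : hfhom F (- f) = - hfhom F f.
Proof. by apply: (addrI (hfhom F f)); rewrite -hfD !subrr hf0. Qed.

Lemma hfMz A B (f : hom A B) (n : int) : hfhom F (f *~ n) = hfhom F f *~ n.
Proof.
have hn (k : nat) : hfhom F (f *+ k) = hfhom F f *+ k.
  by elim: k => [|k IHk]; rewrite ?mulr0n ?hf0 // !mulrS hfD IHk.
by case: n => n; rewrite ?NegzE -?nmulrn ?hfN -?pmulrn hn.
Qed.

Lemma hf_iso A B (f : hom A B) : is_iso f -> is_iso (hfhom F f).
Proof.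
by case=> g [gf fg]; exists (hfhom F g); rewrite -!hfM gf fg !hf1.
Qed.

Definition hf_form x : sesq D :=
  @Sesq D (F x) (hfdelta F x \oc hfhom F (smor x)).

Lemma hf_adj A B (f : hom A (dual B)) :
  star (hfdelta F B \oc hfhom F f) \oc omega (F B) =
  hfdelta F A \oc hfhom F (star f \oc omega B).
Proof.
by rewrite starM -compA -hfdelta_omega compA -hfdelta_nat -compA -hfM.
Qed.

Lemma hf_isometric x y : isometric x y -> isometric (hf_form x) (hf_form y).
Proof.
case=> f [fi fE]; exists (hfhom F f); split; first exact: hf_iso.
by rewrite /= {1}fE !hfM !compA hfdelta_nat.
Qed.

Lemma hf_unimodular x : unimodular x -> unimodular (hf_form x).
Proof.
case=> h1 h2; split; first exact/is_iso_comp/hf_iso/h1/hfdelta_iso.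
by rewrite hf_adj; apply/is_iso_comp/hf_iso/h2/hfdelta_iso.
Qed.

Lemma hf_eherm eps x : eherm eps x -> eherm eps (hf_form x).
Proof. by move=> xE; rewrite /eherm hf_adj /= {1}xE hfMz compMzr. Qed.

Lemma hf_bip_iso A B (A' B' : D) (f : hom (F A) A') (g : hom (F B) B') :
  is_iso f -> is_iso g ->
  is_iso (injl \oc f \oc hfhom F prjl
          + injr \oc g \oc hfhom F (prjr : hom (bip A B) B)).
Proof.
case=> f' [f'f ff'] [g' [g'g gg']].
exists (hfhom F injl \oc f' \oc prjl + hfhom F injr \oc g' \oc prjr); split.
- rewrite !compDl !compDr !compA -!(compA _ prjl) -!(compA _ prjr).
  rewrite prjl_injl prjr_injr prjl_injr prjr_injl.
  rewrite !compc0 !comp0c !compc1 addr0 add0r -!(compA (hfhom F injl)).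
  by rewrite -!(compA (hfhom F injr)) f'f g'g !comp1c -!hfM -hfD bip_id hf1.
- rewrite !compDl !compDr !compA.
  rewrite -!(compA _ (hfhom F prjl)) -!(compA _ (hfhom F prjr)) -!hfM.
  rewrite prjl_injl prjr_injr prjl_injr prjr_injl !hf0 !hf1.
  rewrite !compc0 !comp0c !compc1 addr0 add0r -!(compA injl).
  by rewrite -!(compA injr) ff' gg' !comp1c bip_id.
Qed.

Lemma hf_orth x y :
  isometric (hf_form (orth x y)) (orth (hf_form x) (hf_form y)).
Proof.
exists (injl \oc idc (F x) \oc hfhom F prjl + injr \oc idc (F y) \oc hfhom F prjr).
split; first by apply: hf_bip_iso; apply: is_iso1.
rewrite /= -compA compDr !compA dsum_injl dsum_injr !compc1.
rewrite compDr starD !starM !compDl !compA.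
rewrite -!(compA _ (star injl)) -!(compA _ (star injr)).
rewrite star_prjl_injl star_prjr_injr star_prjl_injr star_prjr_injl.
rewrite !compc0 !comp0c !compc1 addr0 add0r.
by rewrite /dsum hfD !hfM compDr !compA !hfdelta_nat.
Qed.

Lemma hf_hyp eps Q :
  isometric (hf_form (hyp_form eps Q)) (hyp_form eps (F Q)).
Proof.
exists (injl \oc idc (F Q) \oc hfhom F prjl + injr \oc hfdelta F Q \oc hfhom F prjr).
split; first by apply: hf_bip_iso; [apply: is_iso1 | apply: hfdelta_iso].
set u := _ + _.
have pl : prjl \oc u = hfhom F prjl.
  by rewrite /u compDr !compA prjl_injl prjl_injr !comp0c addr0 !comp1c.
have pr : prjr \oc u = hfdelta F Q \oc hfhom F prjr.
  by rewrite /u compDr !compA prjr_injl prjr_injr !comp0c add0r !comp1c.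
rewrite /= compDr compDl !compA -!starM -!(compA _ _ u) pl pr starM.
rewrite !compc1 !hfD !hfM !compDr !compA !hfdelta_nat; congr (_ + _).
rewrite -!compA; congr (_ \oc _); rewrite !compA.
by rewrite hfMz !compMzr hfdelta_omega compMzl.
Qed.

Lemma hf_reflexive Q : reflexive_ob Q -> reflexive_ob (F Q).
Proof.
rewrite /reflexive_ob => Qr.
have [g [gd dg]] := is_iso_star (hfdelta_iso F Q).
have -> : omega (F Q) = g \oc (hfdelta F (dual Q) \oc hfhom F (omega Q)).
  by rewrite hfdelta_omega compA gd comp1c.
apply: is_iso_comp; first by exists (star (hfdelta F Q)).
exact/is_iso_comp/hf_iso/Qr/hfdelta_iso.
Qed.

Lemma hf_hyperbolic eps x : hyperbolic eps x -> hyperbolic eps (hf_form x).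
Proof.
case=> Q [Qr xQ]; exists (F Q); split; first exact: hf_reflexive.
by apply: isometric_trans (hf_isometric xQ) _; apply: hf_hyp.
Qed.

Definition hf_uform eps (x : uform C eps) : uform D eps :=
  UForm (hf_unimodular (uformU x)) (hf_eherm (uformE x)).

Definition Wmap eps : W eps C -> W eps D :=
  witt_lift (fun x : uform C eps => Wclass (hf_uform x)).

Fact Wmap_iso eps (x y : uform C eps) :
  uisometric x y -> Wclass (hf_uform x) = Wclass (hf_uform y).
Proof. by move=> xy; apply: witt_class_iso; apply: hf_isometric. Qed.

Fact Wmap_op eps (x y : uform C eps) :
  Wclass (hf_uform (uorth x y)) = Wclass (hf_uform x) + Wclass (hf_uform y).
Proof.
by rewrite -[RHS]witt_class_op; apply: witt_class_iso; apply: hf_orth.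
Qed.

Fact Wmap_hyp eps (x : uform C eps) :
  uhyperbolic x -> Wclass (hf_uform x) = 0.
Proof. by move=> xh; apply: witt_class_eq0; apply: hf_hyperbolic. Qed.

Lemma WmapE eps (x : uform C eps) : Wmap (Wclass x) = Wclass (hf_uform x).
Proof. exact: (witt_liftE (@Wmap_iso _) (@Wmap_op _) (@Wmap_hyp _)). Qed.

Lemma WmapB eps : zmod_morphism (@Wmap eps).
Proof. exact: (witt_liftB (@Wmap_iso _) (@Wmap_op _) (@Wmap_hyp _)). Qed.

Definition hf_ar2_ob (X : Ar2 C) : Ar2 D :=
  @Ar2Ob D (F (ar2M X)) (F (ar2N X))
    (hfdelta F _ \oc hfhom F (ar2f X)) (hfdelta F _ \oc hfhom F (ar2g X)).

Fact hf_ar2f (X Y : Ar2 C) (p : ar2_hom X Y) :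
  ar2f (hf_ar2_ob Y) \oc hfhom F (ar2_phi p) =
  star (hfhom F (ar2_psi p)) \oc ar2f (hf_ar2_ob X).
Proof. by rewrite /= -compA -hfM ar2_homf hfM compA hfdelta_nat -compA. Qed.
Fact hf_ar2g (X Y : Ar2 C) (p : ar2_hom X Y) :
  ar2g (hf_ar2_ob Y) \oc hfhom F (ar2_phi p) =
  star (hfhom F (ar2_psi p)) \oc ar2g (hf_ar2_ob X).
Proof. by rewrite /= -compA -hfM ar2_homg hfM compA hfdelta_nat -compA. Qed.
Definition hf_ar2_hom (X Y : Ar2 C) (p : ar2_hom X Y) :
  ar2_hom (hf_ar2_ob X) (hf_ar2_ob Y) :=
  @ar2_mor D (hf_ar2_ob X) (hf_ar2_ob Y) _ _ (hf_ar2f p) (hf_ar2g p).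

Fact hf_ar2_deltaf (X : Ar2 C) :
  ar2f (ar2_dual (hf_ar2_ob X)) \oc idc (F (ar2N X)) =
  star (idc (F (ar2M X))) \oc ar2f (hf_ar2_ob (ar2_dual X)).
Proof. by rewrite /= hf_adj star1 comp1c compc1. Qed.
Fact hf_ar2_deltag (X : Ar2 C) :
  ar2g (ar2_dual (hf_ar2_ob X)) \oc idc (F (ar2N X)) =
  star (idc (F (ar2M X))) \oc ar2g (hf_ar2_ob (ar2_dual X)).
Proof. by rewrite /= hf_adj star1 comp1c compc1. Qed.
Definition hf_ar2_delta (X : Ar2 C) :
  ar2_hom (hf_ar2_ob (ar2_dual X)) (ar2_dual (hf_ar2_ob X)) :=
  @ar2_mor D (hf_ar2_ob (ar2_dual X)) (ar2_dual (hf_ar2_ob X))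
    (idc (F (ar2N X))) (idc (F (ar2M X))) (hf_ar2_deltaf X) (hf_ar2_deltag X).

Fact hf_ar2_delta'f (X : Ar2 C) :
  ar2f (hf_ar2_ob (ar2_dual X)) \oc idc (F (ar2N X)) =
  star (idc (F (ar2M X))) \oc ar2f (ar2_dual (hf_ar2_ob X)).
Proof. by rewrite /= hf_adj star1 comp1c compc1. Qed.
Fact hf_ar2_delta'g (X : Ar2 C) :
  ar2g (hf_ar2_ob (ar2_dual X)) \oc idc (F (ar2N X)) =
  star (idc (F (ar2M X))) \oc ar2g (ar2_dual (hf_ar2_ob X)).
Proof. by rewrite /= hf_adj star1 comp1c compc1. Qed.

Definition hf_ar2 : hermFunctor (Ar2 C) (Ar2 D).
Proof.
refine (@HermFunctor (Ar2 C) (Ar2 D) hf_ar2_ob hf_ar2_hom _ _ _ hf_ar2_delta _ _ _).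
- by move=> X Y f g; apply: ar2_homP; apply: hfD.
- by move=> X; apply: ar2_homP; apply: hf1.
- by move=> X Y Z g f; apply: ar2_homP; apply: hfM.
- move=> X; exists (@ar2_mor D (ar2_dual (hf_ar2_ob X)) (hf_ar2_ob (ar2_dual X))
    (idc (F (ar2N X))) (idc (F (ar2M X))) (hf_ar2_delta'f X) (hf_ar2_delta'g X)).
  by split; apply: ar2_homP; apply: comp1c.
- by move=> X Y f; apply: ar2_homP; rewrite /ar2_phi /ar2_psi /= comp1c compc1.
- by move=> X; apply: ar2_homP; rewrite /ar2_phi /ar2_psi /= /ar2_phi /ar2_psi /= !(comp1c, hf1).
Defined.

End HermFunctor.
Arguments Wmap {C D} F eps.

Section HermFunctorWS.
Variables (C D : hermCat) (F : hermFunctor C D).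
Implicit Types x y : sesq C.

Lemma hf_ar2_form x :
  isometric (ar2_form (hf_form F x)) (hf_form (hf_ar2 F) (ar2_form x)).
Proof.
set y := ar2_form _; set z := hf_form _ _.
have h1 : ar2f (sob z) \oc idc (F x) = star (idc (F x)) \oc ar2f (sob y).
  by rewrite /= hf_adj star1 comp1c compc1.
have h2 : ar2g (sob z) \oc idc (F x) = star (idc (F x)) \oc ar2g (sob y).
  by rewrite /= star1 comp1c compc1.
have h3 : ar2f (sob y) \oc idc (F x) = star (idc (F x)) \oc ar2f (sob z).
  by rewrite /= hf_adj star1 comp1c compc1.
have h4 : ar2g (sob y) \oc idc (F x) = star (idc (F x)) \oc ar2g (sob z).
  by rewrite /= star1 comp1c compc1.
exists (@ar2_mor D (sob y) (sob z) (idc (F x)) (idc (F x)) h1 h2); split.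
  exists (@ar2_mor D (sob z) (sob y) (idc (F x)) (idc (F x)) h3 h4).
  by split; apply: ar2_homP; apply: comp1c.
apply: ar2_homP.
- change (idc (F x) =
    idc (F x) \oc (idc (F x) \oc hfhom F (idc (sob x))) \oc idc (F x)).
  by rewrite hf1 !comp1c.
- change (idc (F x) =
    idc (F x) \oc (hfhom F (idc (sob x)) \oc idc (F x) \oc idc (F x))).
  by rewrite hf1 !comp1c.
Qed.

Lemma hf_sesq_hyperbolic x : sesq_hyperbolic x -> sesq_hyperbolic (hf_form F x).
Proof.
move=> /(hf_hyperbolic (hf_ar2 F)) [Q [Qr xQ]]; exists Q; split => //.
exact: isometric_trans (hf_ar2_form x) xQ.
Qed.

Definition WSmap : WS C -> WS D :=
  witt_lift (fun x : sesq C => WSclass (hf_form F x)).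

Fact WSmap_iso x y : isometric x y ->
  WSclass (hf_form F x) = WSclass (hf_form F y).
Proof. by move=> xy; apply: witt_class_iso; apply: hf_isometric. Qed.

Fact WSmap_op x y : WSclass (hf_form F (orth x y)) =
  WSclass (hf_form F x) + WSclass (hf_form F y).
Proof.
by rewrite -[RHS]witt_class_op; apply: witt_class_iso; apply: hf_orth.
Qed.

Fact WSmap_hyp x : sesq_hyperbolic x -> WSclass (hf_form F x) = 0.
Proof. by move=> xh; apply: witt_class_eq0; apply: hf_sesq_hyperbolic. Qed.

Lemma WSmapE x : WSmap (WSclass x) = WSclass (hf_form F x).
Proof. exact: (witt_liftE WSmap_iso WSmap_op WSmap_hyp). Qed.

Lemma WSmapB : zmod_morphism WSmap.
Proof. exact: (witt_liftB WSmap_iso WSmap_op WSmap_hyp). Qed.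

End HermFunctorWS.

Section Karoubi.
Variable D : addCat.

Record kar_ob := KarOb {
  kob : D;
  kidem : hom kob kob;
  kidemP : kidem \oc kidem = kidem
}.
Implicit Types X Y Z : kar_ob.

(* That is, [f] lies in [kidem Y \oc hom \oc kidem X], see [kar_predP].        *)
Definition kar_pred X Y : hom (kob X) (kob Y) -> bool :=
  fun f => kidem Y \oc f \oc kidem X == f.

Fact kar_pred_closed X Y : zmod_closed (@kar_pred X Y).
Proof.
split; first by rewrite unfold_in compc0 comp0c.
by move=> f g; rewrite !unfold_in => /eqP hf /eqP hg; rewrite compBr compBl hf hg.
Qed.
HB.instance Definition _ X Y :=
  GRing.isZmodClosed.Build _ (@kar_pred X Y) (@kar_pred_closed X Y).

Definition kar_hom X Y : Type := {f | f \in @kar_pred X Y}.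
HB.instance Definition _ X Y := [isSub of kar_hom X Y for @sval _ _].
HB.instance Definition _ X Y := [Choice of kar_hom X Y by <:].
HB.instance Definition _ X Y := [SubChoice_isSubZmodule of kar_hom X Y by <:].

Lemma kar_predP X Y (f : hom (kob X) (kob Y)) :
  f \in @kar_pred X Y <-> exists g, f = kidem Y \oc g \oc kidem X.
Proof.
split=> [/eqP <-|[g ->]]; first by exists f.
by apply/eqP; rewrite !compA kidemP -!compA kidemP.
Qed.

Lemma kar_homP X Y (f g : kar_hom X Y) : val f = val g -> f = g.
Proof. exact: val_inj. Qed.

Lemma kar_homE X Y (f : kar_hom X Y) : kidem Y \oc val f \oc kidem X = val f.
Proof. by apply/eqP; apply: (valP f). Qed.

Lemma kar_homl X Y (f : kar_hom X Y) : kidem Y \oc val f = val f.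
Proof. by rewrite -[in LHS](kar_homE f) !compA kidemP kar_homE. Qed.

Lemma kar_homr X Y (f : kar_hom X Y) : val f \oc kidem X = val f.
Proof. by rewrite -[in LHS](kar_homE f) -!compA kidemP !compA kar_homE. Qed.

Definition kar_mor X Y (f : hom (kob X) (kob Y))
    (hf : kidem Y \oc f \oc kidem X = f) : kar_hom X Y :=
  exist _ f (introT eqP hf : f \in @kar_pred X Y).

Fact kar_id_subproof X : kidem X \oc kidem X \oc kidem X = kidem X.
Proof. by rewrite !kidemP. Qed.
Definition kar_id X : kar_hom X X := kar_mor (kar_id_subproof X).

Fact kar_comp_subproof X Y Z (g : kar_hom Y Z) (f : kar_hom X Y) :
  kidem Z \oc (val g \oc val f) \oc kidem X = val g \oc val f.
Proof. by rewrite !compA kar_homl -compA kar_homr. Qed.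
Definition kar_comp X Y Z (g : kar_hom Y Z) (f : kar_hom X Y) : kar_hom X Z :=
  kar_mor (kar_comp_subproof g f).

Fact kar_zob_subproof : idc (zob D) \oc idc (zob D) = idc (zob D).
Proof. exact: comp1c. Qed.
Definition kar_zob : kar_ob := KarOb kar_zob_subproof.

Definition kar_bip_idem X Y : hom (bip (kob X) (kob Y)) (bip (kob X) (kob Y)) :=
  injl \oc kidem X \oc prjl + injr \oc kidem Y \oc prjr.

Lemma kar_prjl_idem X Y : prjl \oc kar_bip_idem X Y = kidem X \oc prjl.
Proof.
by rewrite /kar_bip_idem compDr !compA prjl_injl prjl_injr !comp0c addr0 comp1c.
Qed.

Lemma kar_prjr_idem X Y : prjr \oc kar_bip_idem X Y = kidem Y \oc prjr.
Proof.
by rewrite /kar_bip_idem compDr !compA prjr_injl prjr_injr !comp0c add0r comp1c.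
Qed.

Lemma kar_idem_injl X Y : kar_bip_idem X Y \oc injl = injl \oc kidem X.
Proof.
by rewrite /kar_bip_idem compDl -!compA prjl_injl prjr_injl !compc0 addr0 compc1.
Qed.

Lemma kar_idem_injr X Y : kar_bip_idem X Y \oc injr = injr \oc kidem Y.
Proof.
by rewrite /kar_bip_idem compDl -!compA prjl_injr prjr_injr !compc0 add0r compc1.
Qed.

Fact kar_bip_subproof X Y :
  kar_bip_idem X Y \oc kar_bip_idem X Y = kar_bip_idem X Y.
Proof.
rewrite {1}/kar_bip_idem compDl -!compA kar_prjl_idem kar_prjr_idem.
by rewrite !(compA (kidem _)) !kidemP !compA.
Qed.
Definition kar_bip X Y : kar_ob := KarOb (kar_bip_subproof X Y).

Fact kar_injl_subproof X Y :
  kidem (kar_bip X Y) \oc (injl \oc kidem X) \oc kidem X = injl \oc kidem X.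
Proof. by rewrite /= compA kar_idem_injl -!compA !kidemP. Qed.
Definition kar_injl X Y : kar_hom X (kar_bip X Y) :=
  @kar_mor X (kar_bip X Y) _ (kar_injl_subproof X Y).

Fact kar_injr_subproof X Y :
  kidem (kar_bip X Y) \oc (injr \oc kidem Y) \oc kidem Y = injr \oc kidem Y.
Proof. by rewrite /= compA kar_idem_injr -!compA !kidemP. Qed.
Definition kar_injr X Y : kar_hom Y (kar_bip X Y) :=
  @kar_mor Y (kar_bip X Y) _ (kar_injr_subproof X Y).

Fact kar_prjl_subproof X Y :
  kidem X \oc (kidem X \oc prjl) \oc kidem (kar_bip X Y) = kidem X \oc prjl.
Proof. by rewrite /= -!compA kar_prjl_idem !compA !kidemP. Qed.
Definition kar_prjl X Y : kar_hom (kar_bip X Y) X :=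
  @kar_mor (kar_bip X Y) X _ (kar_prjl_subproof X Y).

Fact kar_prjr_subproof X Y :
  kidem Y \oc (kidem Y \oc prjr) \oc kidem (kar_bip X Y) = kidem Y \oc prjr.
Proof. by rewrite /= -!compA kar_prjr_idem !compA !kidemP. Qed.
Definition kar_prjr X Y : kar_hom (kar_bip X Y) Y :=
  @kar_mor (kar_bip X Y) Y _ (kar_prjr_subproof X Y).

Definition kar_addCat : addCat.
Proof.
refine (@AddCat kar_ob (fun X Y => (kar_hom X Y : zmodType)) kar_id kar_comp
  _ _ _ _ _ kar_zob _ kar_bip kar_injl kar_injr kar_prjl kar_prjr _ _ _ _ _).
- by move=> X Y f; apply: kar_homP; apply: kar_homl.
- by move=> X Y f; apply: kar_homP; apply: kar_homr.
- by move=> X Y Z T h g f; apply: kar_homP; apply: compA.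
- by move=> X Y Z g g' f; apply: kar_homP; apply: compDl.
- by move=> X Y Z g f f'; apply: kar_homP; apply: compDr.
- by apply: kar_homP; apply: idc_zob.
- move=> X Y; apply: kar_homP; rewrite /=.
  by rewrite -compA (compA prjl) prjl_injl comp1c kidemP.
- move=> X Y; apply: kar_homP; rewrite /=.
  by rewrite -compA (compA prjr) prjr_injr comp1c kidemP.
- move=> X Y; apply: kar_homP; rewrite /=.
  by rewrite -compA (compA prjl) prjl_injr comp0c compc0.
- move=> X Y; apply: kar_homP; rewrite /=.
  by rewrite -compA (compA prjr) prjr_injl comp0c compc0.
- move=> X Y; apply: kar_homP; rewrite /=.
  by rewrite -!compA !(compA (kidem _)) !kidemP !compA.
Defined.

End Karoubi.

Section KaroubiHerm.
Variable D : hermCat.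
Implicit Types X Y Z : kar_ob D.

Fact kar_dual_subproof X : star (kidem X) \oc star (kidem X) = star (kidem X).
Proof. by rewrite -starM kidemP. Qed.
Definition kar_dual X : kar_ob D := KarOb (kar_dual_subproof X).

Fact kar_star_subproof X Y (f : kar_hom X Y) :
  kidem (kar_dual X) \oc star (val f) \oc kidem (kar_dual Y) = star (val f).
Proof. by rewrite /= -!starM compA kar_homE. Qed.
Definition kar_star X Y (f : kar_hom X Y) : kar_hom (kar_dual Y) (kar_dual X) :=
  @kar_mor _ (kar_dual Y) (kar_dual X) _ (kar_star_subproof f).

Fact kar_omega_subproof X :
  let w := star (star (kidem X)) \oc omega (kob X) \oc kidem X in
  kidem (kar_dual (kar_dual X)) \oc w \oc kidem X = w.
Proof. by rewrite /= !compA -!starM kidemP -!compA kidemP. Qed.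
Definition kar_omega X : kar_hom X (kar_dual (kar_dual X)) :=
  @kar_mor _ X (kar_dual (kar_dual X)) _ (kar_omega_subproof X).

Definition karoubi : hermCat.
Proof.
refine (@HermCat (kar_addCat D) kar_dual kar_star _ _ _ kar_omega _ _).
- by move=> X Y f g; apply: kar_homP; apply: starD.
- by move=> X; apply: kar_homP.
- by move=> X Y Z g f; apply: kar_homP; apply: starM.
- move=> X Y f; apply: kar_homP.
  change (star (star (kidem Y)) \oc omega _ \oc kidem Y \oc val f =
    star (star (val f)) \oc (star (star (kidem X)) \oc omega _ \oc kidem X)).
  rewrite -(compA _ (kidem Y)) kar_homl -compA omega_nat !compA -!starM.
  by rewrite kar_homl kar_homr -omega_nat -compA kar_homr.
- move=> X; apply: kar_homP.
  have wE Y : star (star (kidem Y)) \oc omega _ \oc kidem Y = omega _ \oc kidem Y.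
    by rewrite -omega_nat -compA kidemP.
  change (star (star (star (kidem X)) \oc omega _ \oc kidem X) \oc
    (star (star (kidem (kar_dual X))) \oc omega _ \oc kidem (kar_dual X)) =
    star (kidem X)).
  rewrite !wE starM -compA (compA (star (omega _))) omega_dual comp1c.
  exact: kar_dual_subproof.
Defined.

Fact kar_incl_subproof (A : D) : idc A \oc idc A = idc A.
Proof. exact: comp1c. Qed.
(* The object of the closure identified with [A].                             *)
Definition kar_incl_ob (A : D) : karoubi := KarOb (kar_incl_subproof A).

Fact kar_incl_hom_subproof (A B : D) (f : hom A B) :
  kidem (kar_incl_ob B) \oc f \oc kidem (kar_incl_ob A) = f.
Proof. by rewrite /= comp1c compc1. Qed.
Definition kar_incl_hom (A B : D) (f : hom A B) :
  kar_hom (kar_incl_ob A) (kar_incl_ob B) :=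
  @kar_mor _ (kar_incl_ob A) (kar_incl_ob B) f (kar_incl_hom_subproof f).

(* [(dual A, idc _)] and the dual [(dual A, star (idc A))] of [(A, idc A)]    *)
(* are equal but not convertible; they are identified by [idc (dual A)].      *)
Fact kar_delta_subproof (A : D) :
  kidem (kar_dual (kar_incl_ob A)) \oc idc (dual A) \oc
    kidem (kar_incl_ob (dual A)) = idc (dual A).
Proof. by rewrite /= star1 !comp1c. Qed.
Definition kar_delta (A : D) :
  kar_hom (kar_incl_ob (dual A)) (kar_dual (kar_incl_ob A)) :=
  @kar_mor _ (kar_incl_ob (dual A)) (kar_dual (kar_incl_ob A)) _
    (kar_delta_subproof A).

Fact kar_delta'_subproof (A : D) :
  kidem (kar_incl_ob (dual A)) \oc idc (dual A) \oc
    kidem (kar_dual (kar_incl_ob A)) = idc (dual A).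
Proof. by rewrite /= star1 !comp1c. Qed.

Definition kar_incl : hermFunctor D karoubi.
Proof.
refine (@HermFunctor D karoubi kar_incl_ob kar_incl_hom _ _ _ kar_delta _ _ _).
- by move=> A B f g; apply: kar_homP.
- by move=> A; apply: kar_homP.
- by move=> A B A' g f; apply: kar_homP.
- move=> A; exists (@kar_mor _ (kar_dual (kar_incl_ob A)) (kar_incl_ob (dual A)) _
    (kar_delta'_subproof A)).
  by split; apply: kar_homP; rewrite /= comp1c ?star1.
- by move=> A B f; apply: kar_homP; rewrite /= comp1c compc1.
- by move=> A; apply: kar_homP; rewrite /= !star1 !comp1c compc1.
Defined.

End KaroubiHerm.

Record linHermCat (K : comNzRingType) := LinHermCat {
  lhcat :> hermCat;
  kscale : forall A B : lhcat, K -> hom A B -> hom A B;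
  kscaleA : forall A B a b (f : @hom lhcat A B),
    kscale a (kscale b f) = kscale (a * b) f;
  kscale1 : forall A B (f : @hom lhcat A B), kscale 1 f = f;
  kscaleDr : forall A B a (f g : @hom lhcat A B),
    kscale a (f + g) = kscale a f + kscale a g;
  kscaleDl : forall A B a b (f : @hom lhcat A B),
    kscale (a + b) f = kscale a f + kscale b f;
  kscale_compl : forall A B C a (g : @hom lhcat B C) (f : hom A B),
    kscale a g \oc f = kscale a (g \oc f);
  kscale_compr : forall A B C a (g : @hom lhcat B C) (f : hom A B),
    g \oc kscale a f = kscale a (g \oc f);
  kscale_star : forall A B a (f : @hom lhcat A B),
    star (kscale a f) = kscale a (star f)
}.

Section KHom.
Variables (K : comNzRingType) (C : linHermCat K) (A B : C).

Definition khom : Type := hom A B.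
HB.instance Definition _ := GRing.Zmodule.on khom.

Fact khom_scaleDr :
  right_distributive (@kscale _ C A B : K -> khom -> khom) +%R.
Proof. exact: kscaleDr. Qed.
Fact khom_scaleDl (f : khom) :
  {morph (fun a => kscale a f : khom) : a b / a + b}.
Proof. by move=> a b; apply: kscaleDl. Qed.
HB.instance Definition _ := GRing.Zmodule_isLmodule.Build K khom
  (@kscaleA _ C A B) (@kscale1 _ C A B) khom_scaleDr khom_scaleDl.

End KHom.

Definition finite_dim (K : nzRingType) (V : lmodType K) :=
  exists (n : nat) (b : 'I_n -> V),
    forall v, exists c : 'I_n -> K, v = \sum_(i < n) c i *: b i.

Lemma morphB_D (U V : zmodType) (h : U -> V) :
  (forall x y, h (x - y) = h x - h y) -> forall x y, h (x + y) = h x + h y.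
Proof.
move=> hB; have h0 : h 0 = 0 by rewrite -(subrr 0) hB subrr.
by move=> x y; rewrite -{1}[y]opprK hB -[- y]sub0r hB h0 sub0r opprK.
Qed.

Section ScalarExtension.
Variables (K : fieldType) (L : fieldExtType K) (C : linHermCat K).

Definition ext_hom (A B : C) : zmodType := tensor (khom A B) L.

Definition etens (A B : C) (f : hom A B) (a : L) : ext_hom A B :=
  tens (f : khom A B) a.

Definition ext_comp (A B A' : C) (y : ext_hom B A') (x : ext_hom A B) :
  ext_hom A A' :=
  tensor_lift (fun (g : khom B A') a =>
    tensor_lift (fun (f : khom A B) b => etens (g \oc f) (a * b)) x) y.

Definition ext_star (A B : C) (x : ext_hom A B) : ext_hom (dual B) (dual A) :=
  tensor_lift (fun (f : khom A B) a => etens (star f) a) x.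

Fact ext_comp_in (A B A' : C) (g : khom B A') (a : L) :
  balanced (fun (f : khom A B) b => etens (g \oc f) (a * b)).
Proof.
split=> [b f f'|f b b'|k f b]; rewrite /etens.
- by rewrite compDr -tensDl.
- by rewrite mulrDr tensDr.
- by rewrite -scalerAr -tensZ; congr tens; apply: kscale_compr.
Qed.
#[local] Hint Resolve ext_comp_in : core.

Fact ext_comp_out (A B A' : C) (x : ext_hom A B) :
  balanced (fun (g : khom B A') a =>
    tensor_lift (fun (f : khom A B) b => etens (g \oc f) (a * b)) x).
Proof.
split=> [a g g'|g a a'|k g a]; elim/tensor_ind: x => [f b|x y hx hy].
- by rewrite !tensor_liftE // /etens compDl -tensDl.
- by rewrite !tensor_liftB // hx hy opprD addrACA.
- by rewrite !tensor_liftE // /etens mulrDl -tensDr.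
- by rewrite !tensor_liftB // hx hy opprD addrACA.
- rewrite !tensor_liftE // /etens -scalerAl -tensZ.
  by congr tens; apply: kscale_compl.
- by rewrite !tensor_liftB // hx hy.
Qed.
#[local] Hint Resolve ext_comp_out : core.

Fact ext_star_in (A B : C) :
  balanced (fun (f : khom A B) a => etens (star f) (a : L)).
Proof.
split=> [b f f'|f b b'|k f b]; rewrite /etens.
- by rewrite starD -tensDl.
- by rewrite tensDr.
- by rewrite -tensZ; congr tens; apply: kscale_star.
Qed.
#[local] Hint Resolve ext_star_in : core.

Lemma ext_compE (A B A' : C) (g : hom B A') (f : hom A B) a b :
  ext_comp (etens g a) (etens f b) = etens (g \oc f) (a * b).
Proof. by rewrite /ext_comp !tensor_liftE. Qed.

Lemma ext_compBl (A B A' : C) (y y' : ext_hom B A') (x : ext_hom A B) :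
  ext_comp (y - y') x = ext_comp y x - ext_comp y' x.
Proof. by rewrite /ext_comp tensor_liftB. Qed.

Lemma ext_compBr (A B A' : C) (y : ext_hom B A') (x x' : ext_hom A B) :
  ext_comp y (x - x') = ext_comp y x - ext_comp y x'.
Proof.
elim/tensor_ind: y => [g a|y y' hy hy']; last first.
  by rewrite !ext_compBl hy hy' opprD addrACA -opprD.
by rewrite /ext_comp !tensor_liftE // tensor_liftB.
Qed.

Lemma ext_starE (A B : C) (f : hom A B) a :
  ext_star (etens f a) = etens (star f) a.
Proof. by rewrite /ext_star tensor_liftE. Qed.

Lemma ext_starB (A B : C) (x y : ext_hom A B) :
  ext_star (x - y) = ext_star x - ext_star y.
Proof. by rewrite /ext_star tensor_liftB. Qed.

Lemma etens0 (A B : C) a : etens (0 : hom A B) a = 0.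
Proof. exact: tens0l. Qed.

Lemma etensD (A B : C) (f g : hom A B) a : etens f a + etens g a = etens (f + g) a.
Proof. by rewrite /etens -tensDl. Qed.

Definition ext_addCat : addCat.
Proof.
refine (@AddCat C ext_hom (fun A => etens (idc A) 1) ext_comp
  _ _ _ _ _ (zob C) _ (@bip C) (fun A B => etens injl 1)
  (fun A B => etens injr 1) (fun A B => etens prjl 1) (fun A B => etens prjr 1)
  _ _ _ _ _).
- move=> A B; elim/tensor_ind => [f a|x y hx hy]; last by rewrite ext_compBr hx hy.
  by rewrite [tens f a]/(etens f a) ext_compE comp1c mul1r.
- move=> A B; elim/tensor_ind => [f a|x y hx hy]; last by rewrite ext_compBl hx hy.
  by rewrite [tens f a]/(etens f a) ext_compE compc1 mulr1.
- move=> A B A1 A2 z y x.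
  elim/tensor_ind: z => [h a|z z' hz hz']; last by rewrite !ext_compBl hz hz'.
  elim/tensor_ind: y => [g b|y y' hy hy'].
    elim/tensor_ind: x => [f c|x x' hx hx']; last by rewrite !ext_compBr hx hx'.
    by rewrite -!/(etens _ _) !ext_compE compA mulrA.
  by rewrite !(ext_compBl, ext_compBr) hy hy'.
- move=> A B A' g g' f.
  exact: (@morphB_D _ _ (fun y => ext_comp y f) (fun x y => ext_compBl x y f)).
- move=> A B A' g f f'.
  exact: (@morphB_D _ _ (ext_comp g) (fun x y => ext_compBr g x y)).
- by rewrite idc_zob etens0.
- by move=> A B; rewrite ext_compE prjl_injl mulr1.
- by move=> A B; rewrite ext_compE prjr_injr mulr1.
- by move=> A B; rewrite ext_compE prjl_injr etens0.
- by move=> A B; rewrite ext_compE prjr_injl etens0.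
- by move=> A B; rewrite !ext_compE mulr1 etensD bip_id.
Defined.

Definition ext_cat : hermCat.
Proof.
refine (@HermCat ext_addCat (@dual C) ext_star _ _ _
  (fun A => etens (omega A) 1) _ _).
- by move=> A B f g; exact: (@morphB_D _ _ (@ext_star A B) (@ext_starB A B)).
- by move=> A; rewrite [LHS]ext_starE star1.
- move=> A B A' y x.
  elim/tensor_ind: y => [g a|y y' hy hy']; last first.
    rewrite [_ \oc x]ext_compBl !ext_starB [RHS]ext_compBr.
    by congr (_ - _); [apply: hy | apply: hy'].
  elim/tensor_ind: x => [f b|x x' hx hx']; last first.
    rewrite [X in ext_star X]ext_compBr !ext_starB [RHS]ext_compBl.
    by congr (_ - _); [apply: hx | apply: hx'].
  rewrite -!/(etens _ _) [_ \oc _]ext_compE !ext_starE [RHS]ext_compE.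
  by rewrite starM mulrC.
- move=> A B; elim/tensor_ind => [f a|x y hx hy].
    rewrite -!/(etens _ _) !ext_starE [LHS]ext_compE [RHS]ext_compE.
    by rewrite omega_nat mulrC.
  rewrite [LHS]ext_compBr !ext_starB [RHS]ext_compBl.
  by congr (_ - _); [apply: hx | apply: hy].
- by move=> A; rewrite ext_starE [LHS]ext_compE omega_dual mulr1.
Defined.

Definition ext_functor : hermFunctor C ext_cat.
Proof.
refine (@HermFunctor C ext_cat (fun A => A) (fun A B f => etens f 1) _ _ _
  (fun A => idc (dual A : ext_cat)) _ _ _).
- by move=> A B f g; rewrite etensD.
- by [].
- by move=> A B A' g f; rewrite [RHS]ext_compE mulr1.
- by move=> A; apply: is_iso1.
- by move=> A B f; rewrite comp1c compc1 [in RHS]/star /= ext_starE.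
- by move=> A; rewrite comp1c star1 comp1c.
Defined.

(* The functor sending [M] to the object [M_L] of the pseudo-abelian closure  *)
(* of the scalar extension, and [f] to [f] tensor [1].                        *)
Definition scalar_ext : hermFunctor C (karoubi ext_cat) :=
  hf_comp (kar_incl ext_cat) ext_functor.

Lemma scalar_ext_formE (x : sesq C) :
  sob (hf_form scalar_ext x) = kar_incl_ob (sob x : ext_cat) /\
  val (smor (hf_form scalar_ext x)) = etens (smor x) 1.
Proof.
split=> //.
change (val (smor (hf_form scalar_ext x))) with
  (idc (dual (sob x) : ext_cat) \oc idc (dual (sob x) : ext_cat)
     \oc (etens (smor x) 1 : @hom ext_cat _ _)).
by rewrite !comp1c.
Qed.

End ScalarExtension.

(* Main.v *)
(* Scharlau transfer. For odd [L : K] there is a K-linear functional s on L   *)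
(* with s 1 = 1 whose form (x, y) |-> s (x y) is the sum of <1> and of m      *)
(* hyperbolic planes, where [L : K] = 2m + 1; in characteristic not 2 it has  *)
(* a hyperbolic basis. Letting L act on A^(2m+1) by multiplication matrices   *)
(* in this basis gives a hermitian functor T from C_L to C, which extends to  *)
(* the pseudo-abelian closure as C is pseudo-abelian. Then T (R x) is the     *)
(* sum of x and of m copies of the tensor product of x with a hyperbolic      *)
(* plane. These copies are hyperbolic, so T is a left inverse of R on Witt    *)
(* groups.                                                                    *)

Require Import Defs.
From HB Require Import structures.
From mathcomp Require Import all_boot all_order all_algebra all_field boolp.

Set Implicit Arguments.
Unset Strict Implicit.
Unset Printing Implicit Defensive.
Import Defs GRing.Theory.
Local Open Scope ring_scope.

(** Injectivity follows from a hermitian functor T back to [C] that sends the scalar extension of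
    every form to a Witt equivalent of that form. T is the transfer along a functional s on L: it
    sends A_L to A tensor L, with L viewed as the quadratic space s (x y) over K.

    The arithmetic is the choice of s ([hyperbolic_basis]). If L = K(x) has degree n = 2m + 1, the
    choice s 1 = 1, s (x^i) = 0 for 0 < i < n makes x, ..., x^m span an isotropic subspace
    orthogonal to 1. L need not be simple, so [half_isotropic_full] carries such a subspace up a
    tower. Nondegeneracy and char K <> 2 complete it to hyperbolic planes.

    Multiplications of L are self-adjoint for s (x y), so [transfer] respects duality; [kar_ext]
    extends it by splitting idempotents. By [transfer_scalar_ext] the composite adds m copies of
    [hplane x] to x, and these vanish by [uhplane_hyperbolic] and [hplane_sesq_hyperbolic]. *)

Lemma directv_sumW (F : fieldType) (vT : vectType F) (I : finType) (P : pred I)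
    (U : I -> {vspace vT}) :
  directv (\sum_i U i) -> directv (\sum_(i | P i) U i).
Proof.
move=> /directv_sum_independent dU; apply/directv_sum_independent => u Uu u0 i Pi.
have := dU (fun j => if P j then u j else 0); rewrite -big_mkcond => /(_ _ u0 i isT).
by rewrite Pi; apply=> j _; case: ifP => // Pj; [apply: Uu | apply: mem0v].
Qed.

(** * Isotropic subspaces of half dimension in an odd extension *)

Section IsotropicSubspace.
Variables (K : fieldType) (L : fieldExtType K).
Implicit Types (E : {subfield L}) (V : {vspace L}).

(** The last condition allows a functional s with s 1 = 1 that kills V and V * V, making V totally
    isotropic and orthogonal to 1; no s is fixed yet, which suits induction on [E]. *)
Definition half_isotropic E V :=
  [/\ (V <= E)%VS, (2 * \dim V).+1 = \dim E & 1 \notin (V + V * V)%VS].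

(* If 1, x, ..., x^(2m) is a basis of E(x) over E, then the products of the   *)
(* elements of V' = V + x E + ... + x^m E lie in V^2 + x E + ... + x^(2m) E,  *)
(* so that 1 stays out of V' + V'^2.                                          *)
Lemma half_isotropic_adjoin E V (x : L) :
  half_isotropic E V -> odd (adjoin_degree E x) ->
  exists V', half_isotropic <<E; x>>%AS V'.
Proof.
case=> VE dimV V1 /[dup] n_odd; set n := adjoin_degree E x => {}n_odd.
pose U (i : 'I_n) := (E * <[x ^+ i]>)%VS; pose m := n./2.
have nE : n = m.*2.+1 by rewrite -[LHS]odd_double_half n_odd.
have dU : directv (\sum_i U i) := Fadjoin_sum_direct E x.
have EU : (<<E; x>> = \sum_i U i)%VS := Fadjoin_eq_sum E x.
pose S1 := (\sum_(i : 'I_n | (0 < i <= m)%N) U i)%VS.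
pose S2 := (\sum_(i : 'I_n | (0 < i)%N) U i)%VS.
have n_gt0 : (0 < n)%N by rewrite nE.
have US2 k : (0 < k < n)%N -> (E * <[x ^+ k]> <= S2)%VS.
  by case/andP=> k0 kn; apply: (sumv_sup (Ordinal kn)).
have S1S2 : (S1 <= S2)%VS.
  by apply/subv_sumP => i /andP[i0 _]; apply: US2; rewrite i0 ltn_ord.
have ES1 : (E * S1 <= S1)%VS.
  rewrite big_distrr; apply/subv_sumP => i Pi /=.
  by rewrite prodvA prodv_id; apply: (sumv_sup i).
have S11 : (S1 * S1 <= S2)%VS.
  rewrite big_distrl; apply/subv_sumP => i /andP[i0 im] /=.
  rewrite big_distrr; apply/subv_sumP => j /andP[j0 jm] /=.
  rewrite prodvA -(prodvA E) (prodvC _ E) prodvA prodv_id -prodvA prodv_line -exprD.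
  (* Since n is odd, i + j <= 2m < n, so the product is not reduced back to degree 0. *)
  have ijn : (i + j < m.*2.+1)%N by rewrite ltnS -addnn leq_add.
  by apply: US2; rewrite addn_gt0 i0 /= -/n -nE in ijn *.
have ES2 : (E :&: S2 = 0)%VS.
  have /directv_sumP/(_ (Ordinal n_gt0) isT) := dU.
  rewrite {1}/U expr0 prodv1 => h; rewrite -[RHS]h; congr (_ :&: _)%VS.
  by apply: eq_bigl => i; rewrite lt0n.
have dimS1 : \dim S1 = (m * \dim E)%N.
  rewrite (directvP (directv_sumW _ dU)) /=.
  have xi0 (i : 'I_n) : x ^+ i != 0.
    rewrite expf_eq0; apply/negP => /andP[i0 /eqP x0].
    have n1 : n = 1%N by rewrite /n x0 adjoin0_deg.
    by have := leq_trans (ltn_ord i) (eq_leq n1); case: (nat_of_ord i) i0.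
  rewrite (eq_bigr (fun=> \dim E)) => [|i _]; last by rewrite dim_cosetv.
  rewrite sum_nat_const; congr (_ * _)%N; rewrite -sum1_card.
  rewrite -(big_mkord (fun i => 0 < i <= m)%N (fun=> 1%N)) big_mkcond.
  rewrite (@big_cat_nat _ _ _ m.+1) //=; last by rewrite nE -addnn ltnS leq_addr.
  rewrite [X in (_ + X)%N]big_nat [X in (_ + X)%N]big1 => [|i /andP[mi _]]; last first.
    by rewrite [(i <= m)%N]leqNgt mi andbF.
  rewrite addn0 big_nat_recl // add0n big_nat (eq_bigr (fun=> 1%N)) => [|i /= ->] //.
  by rewrite -big_nat sum_nat_const_nat subn0 muln1.
have VS1 : (V :&: S1 = 0)%VS.
  apply/eqP; rewrite -subv0 -ES2 subv_cap (subv_trans (capvSl _ _) VE).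
  exact: subv_trans (capvSr _ _) S1S2.
exists (V + S1)%VS; split.
- rewrite subv_add (subv_trans VE) ?subv_adjoin //=.
  by rewrite [X in (_ <= X)%VS]EU; apply/subv_sumP => i _; apply: (sumv_sup i).
- rewrite (dimv_disjoint_sum VS1) dimS1 [RHS]dim_Fadjoin -/n nE mulnDr -addSn dimV.
  by rewrite [RHS]mulSn -mul2n mulnA.
apply: contra V1 => h1.
have VVE : (V + V * V <= E)%VS.
  by rewrite subv_add VE -[X in (_ <= X)%VS](prodv_id E) prodvS.
have : (1 : L) \in ((V + V * V) + S2)%VS.
  apply: subvP h1; rewrite prodvDl !prodvDr.
  have S2T : (S2 <= V + V * V + S2)%VS by rewrite addvSr.
  have VS1S2 : (V * S1 <= S2)%VS.
    exact: subv_trans (subv_trans (prodvSl S1 VE) ES1) S1S2.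
  rewrite [(S1 * V)%VS]prodvC !subv_add -addvA addvSl addvA.
  rewrite (subv_trans S1S2) // (subv_trans VS1S2) // (subv_trans S11) //.
  by rewrite (subv_trans _ (addvSl _ _)) ?addvSr.
(* The component t = 1 - u lies in E, which meets S2 in 0. *)
case/memv_addP => u Vu [t S2t tE].
have t0 : t = 0.
  apply/eqP; rewrite -memv0 -ES2 memv_cap S2t andbT.
  by rewrite (canRL (addKr _) (esym tE)) rpredD ?rpredN ?rpred1 // (subvP VVE).
by rewrite tE t0 addr0.
Qed.

(** Induction on the codimension of E, from E = K and V = 0. Each adjunction degree divides [L : K],
    hence is odd. *)
Lemma half_isotropic_full : odd (\dim {:L}) -> exists V, half_isotropic {:L}%AS V.
Proof.
move=> L_odd.
suff: forall d E, (\dim {:L} - \dim E <= d)%N -> (exists V, half_isotropic E V) ->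
    exists V, half_isotropic {:L}%AS V.
  move=> /(_ _ 1%AS (leqnn _)); apply; exists 0%VS.
  by split; rewrite ?sub0v ?dimv0 ?dimv1 // prod0v addv0 memv0 oner_eq0.
elim=> [|d IHd] E dE [V VE].
  have EL : E = {:L}%AS.
    by apply/val_inj/eqP; rewrite /= eqEdim subvf -subn_eq0 -leqn0.
  by exists V; rewrite -EL.
have [LE|/subvPn[x _ xE]] := boolP ({:L} <= E)%VS.
  apply: (IHd E); last by exists V.
  have /eqP -> : (\dim {:L} - \dim E == 0)%N by rewrite subn_eq0 dimvS.
  exact: leq0n.
have Ex_odd : odd (adjoin_degree E x).
  have /dvdnP[k kE] := field_dimS (subvf <<E; x>>%AS).
  by move: L_odd; rewrite [\dim _]kE dim_Fadjoin !oddM => /andP[_ /andP[]].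
apply: (IHd <<E; x>>%AS) (half_isotropic_adjoin VE Ex_odd).
rewrite -ltnS (leq_trans _ dE) // ltn_sub2l //.
  rewrite ltnNge; apply: contra xE => h; suff -> : E = {:L}%AS by rewrite memvf.
  by apply/val_inj/eqP; rewrite /= eqEdim subvf.
rewrite ltn_neqAle dimvS ?subv_adjoin // andbT; apply: contraNneq xE => h.
have /eqP -> : (E == <<E; x>> :> {vspace L})%VS by rewrite eqEdim subv_adjoin h leqnn.
exact: memv_adjoin.
Qed.

End IsotropicSubspace.

(** * The quadratic space L and its hyperbolic basis *)

(** The form s (x y) is nondegenerate, as s (u u^-1) = 1 for u <> 0. So the Gram matrix of [v]
    against a basis of L has a right inverse, whose columns give [w]. *)
Lemma dual_family (K : fieldType) (L : fieldExtType K) (s : {scalar L})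
    (m : nat) (v : m.-tuple L) : s 1 = 1 -> free v ->
  exists w : nat -> L, forall i j, (i < m)%N -> (j < m)%N ->
    s (v`_i * w j) = (i == j)%:R.
Proof.
move=> s1 v_free; pose e := vbasis {:L}.
pose G := \matrix_(i < m, j < \dim {:L}) s (v`_i * e`_j).
have /row_freeP[D GD] : row_free G.
  rewrite -kermx_eq0; apply/rowV0P => c /sub_kermxP cG; apply/rowP => i.
  rewrite mxE; pose u := \sum_(i < m) c 0 i *: v`_i.
  have su y : s (u * y) = 0.
    rewrite (coord_vbasis (memvf y)) mulr_sumr linear_sum big1 // => j _.
    rewrite -scalerAr linearZ /= -/e; suff -> : s (u * e`_j) = 0 by rewrite mulr0.
    have := congr1 (fun A : 'M_(_, _) => A 0 j) cG; rewrite !mxE => <-.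
    rewrite mulr_suml linear_sum; apply: eq_bigr => k _.
    by rewrite mxE -scalerAl linearZ.
  have u0 : u = 0.
    apply/eqP/negPn/negP => u_neq0; have := su u^-1.
    by rewrite divff // s1 => /eqP; rewrite oner_eq0.
  by move/freeP: v_free; apply.
exists (fun j => oapp (fun j : 'I_m => \sum_k D k j *: e`_k) 0 (insub j)).
move=> i j im jm; rewrite insubT /= mulr_sumr linear_sum.
have := congr1 (fun A : 'M_m => A (Ordinal im) (Ordinal jm)) GD.
rewrite !mxE => <-; apply: eq_bigr => k _.
by rewrite !mxE -scalerAr linearZ /= mulrC.
Qed.

Section HyperbolicBasis.
Variables (K : fieldType) (L : fieldExtType K).

(** Take the coefficient of 1 in the projection onto K 1 along V + V * V. *)
Lemma functional_half_isotropic V : @half_isotropic K L {:L}%AS V ->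
  exists s : {scalar L}, [/\ s 1 = 1, {in V, forall x, s x = 0} &
    {in V &, forall x y, s (x * y) = 0}].
Proof.
case=> _ _; set U := (V + V * V)%VS => U1.
have d1 : (1 :&: U = 0)%VS.
  apply/eqP; rewrite -subv0; apply/subvP => x; rewrite memv_cap memv0.
  case/andP => /vlineP[k ->]; have [->|k0 kU] := eqVneq k 0; first by rewrite scale0r.
  by case/negP: U1; rewrite -(scale1r 1) -(mulVf k0) -scalerA memvZ.
pose p := daddv_pi 1%VS U; pose s := (coord [tuple 1 : L] ord0 \o p : {scalar L}).
have sU : {in U, forall x, s x = 0}.
  move=> x Ux; rewrite /s /=; suff -> : p x = 0 by rewrite linear0.
  have := daddv_pi_add d1 (subvP (addvSr 1%VS U) _ Ux).
  have d1' : (U :&: 1 = 0)%VS by rewrite capvC.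
  by rewrite (daddv_pi_id d1' Ux) -/p -[X in _ = X]add0r => /addIr.
exists s; split.
- rewrite /s /= /p daddv_pi_id ?mem1v //.
  by rewrite (coord_free ord0 ord0) ?seq1_free ?oner_eq0.
- by move=> x Vx; apply: sU; apply: (subvP (addvSl _ _)).
- by move=> x y Vx Vy; apply/sU/(subvP (addvSr _ _))/memv_mul.
Qed.

(* 0 is fixed, 2k + 1 and 2k + 2 are exchanged.                               *)
Definition hswap (k : nat) : nat := if odd k then k.+1 else k.-1.

Lemma hswapK : involutive hswap.
Proof. by case=> // k; rewrite /hswap /=; case: (boolP (odd k)) => /= [|/negPf] ->. Qed.

Lemma hswap_lt m k : (k < m.*2.+1)%N -> (hswap k < m.*2.+1)%N.
Proof.
rewrite /hswap; case: ifP => [k_odd|_ km]; last exact: leq_ltn_trans (leq_pred k) km.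
rewrite !ltnS leq_eqVlt => /predU1P[kE|//].
by rewrite kE odd_double in k_odd.
Qed.

Variant hindex_spec m : nat -> Type :=
| Hindex0 : hindex_spec m 0
| HindexOdd a of (a < m)%N : hindex_spec m a.*2.+1
| HindexEven a of (a < m)%N : hindex_spec m a.*2.+2.

Lemma hindexP m k : (k < m.*2.+1)%N -> hindex_spec m k.
Proof.
case: k => [|k]; first by constructor.
rewrite ltnS -[k]odd_double_half; case: (odd k) => /=; rewrite ?add1n ?add0n => km.
  by constructor; rewrite -ltn_double (leq_trans _ km).
by constructor; rewrite -ltn_double.
Qed.

(* The form (x, y) |-> s (x y) is the orthogonal sum of <1> and of m          *)
(* hyperbolic planes.                                                         *)
Lemma hyperbolic_basis : odd (\dim {:L}) -> 2%N \notin [pchar K] ->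
  exists (m : nat) (s : {scalar L}) (b : nat -> L),
  (forall i j, (i < m.*2.+1)%N -> (j < m.*2.+1)%N ->
        s (b i * b j) = (j == hswap i)%:R) /\
  (forall y, y = \sum_(k < m.*2.+1) s (b (hswap k) * y) *: b k).
Proof.
move=> L_odd K_char.
have K2 : 2 != 0 :> K by move: K_char; rewrite inE.
have [V hV] := half_isotropic_full L_odd.
have [_ dimV _] := hV; have [s [s1 sV sVV]] := functional_half_isotropic hV.
set m := \dim V in dimV; pose v := vbasis V.
have vV i : v`_i \in V.
  have [im|mi] := ltnP i (size v); last by rewrite nth_default ?mem0v.
  by rewrite vbasis_mem // mem_nth.
have [w0 w0E] := dual_family s1 (basis_free (vbasisP V)).
(* Made orthogonal to 1; pairings with V are unchanged, as s kills V. *)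
pose w1 j := w0 j - (s (w0 j))%:A.
have vw1 i j : (i < m)%N -> (j < m)%N -> s (v`_i * w1 j) = (i == j)%:R.
  by move=> im jm; rewrite mulrBr linearB /= w0E // -scalerAr linearZ /= mulr1
    (sV v`_i) // mulr0 subr0.
have sw1 j : s (w1 j) = 0 by rewrite linearB linearZ /= s1 mulr1 subrr.
(* Half of the Gram matrix of [w1] is subtracted on each side, so that the [w j] become isotropic;
   this is where char K <> 2 enters. *)
pose c j := \sum_(k < m) (s (w1 j * w1 k) / 2) *: v`_k; pose w j := w1 j - c j.
have cV j : c j \in V.
  by apply: rpred_sum => k _; apply: rpredZ.
have vw i j : (i < m)%N -> (j < m)%N -> s (v`_i * w j) = (i == j)%:R.
  by move=> im jm; rewrite mulrBr linearB /= vw1 // sVV // subr0.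
have sw j : s (w j) = 0 by rewrite linearB /= sw1 sV // subr0.
have w1c i j : (i < m)%N -> s (w1 i * c j) = s (w1 j * w1 i) / 2.
  move=> im; rewrite mulr_sumr linear_sum (bigD1 (Ordinal im)) //=.
  rewrite -scalerAr linearZ /= mulrC [w1 i * _]mulrC vw1 // eqxx mul1r big1 ?addr0 //.
  move=> k /negPf ki; rewrite -scalerAr linearZ /= [w1 i * _]mulrC vw1 //.
  by rewrite -val_eqE /= in ki; rewrite ki mulr0.
have ww i j : (i < m)%N -> (j < m)%N -> s (w i * w j) = 0.
  move=> im jm; rewrite /w mulrBr !(mulrBl _ (w1 i)) !linearB /= (sVV _ _ (cV i) (cV j)).
  rewrite w1c // [c i * _]mulrC w1c // [w1 j * w1 i]mulrC subr0.
  by rewrite -addrA -opprD -mulrDl -mulr2n -[X in X / _]mulr_natr mulfK // subrr.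
pose b k := if k == 0%N then 1 else if odd k then v`_k./2 else w k./2.-1.
have b0 : b 0%N = 1 by [].
have bo a : b a.*2.+1 = v`_a by rewrite /b /= odd_double /= uphalf_double.
have be a : b a.*2.+2 = w a by rewrite /b /= odd_double /= doubleK.
have bb i j : (i < m.*2.+1)%N -> (j < m.*2.+1)%N -> s (b i * b j) = (j == hswap i)%:R.
  move=> /hindexP hi /hindexP hj.
  have parity x y : (x.*2 == y.*2.+1) = false.
    by apply/eqP => /(congr1 odd) /=; rewrite !odd_double.
  case: hi => [|a am|a am]; case: hj => [|d dm|d dm];
    rewrite ?b0 ?bo ?be ?mul1r ?mulr1 ?s1 ?sw ?(sV _ (vV _)) ?ww ?vw //=
      /hswap /= ?odd_double //= ?eqSS ?(inj_eq double_inj) ?parity //=.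
  - by rewrite sVV.
  - by rewrite eq_sym.
  - by rewrite mulrC vw.
  - by rewrite eq_sym parity.
exists m, s, b; split=> // y.
pose X := [tuple b i | i < m.*2.+1].
have Xi (i : 'I_m.*2.+1) : X`_i = b i by rewrite -tnth_nth tnth_mktuple.
(* Pairing with [b (hswap j)] reads off the j-th coordinate; hence freeness, and a basis by
   dimension. *)
have sX (d : 'I_m.*2.+1 -> K) (j : 'I_m.*2.+1) :
    s (b (hswap j) * \sum_i d i *: X`_i) = d j.
  rewrite mulr_sumr linear_sum (bigD1 j) //= -scalerAr linearZ /= Xi bb ?hswap_lt //.
  rewrite hswapK eqxx mulr1 big1 ?addr0 // => k kj.
  by rewrite -scalerAr linearZ /= Xi bb ?hswap_lt // hswapK val_eqE (negPf kj) mulr0.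
have X_free : free X.
  by apply/freeP => d d0 j; rewrite -(sX d j) d0 mulr0 linear0.
have X_basis : basis_of {:L} X.
  by rewrite basisEfree X_free subvf size_tuple -dimV mul2n leqnn.
rewrite {1}(coord_basis X_basis (memvf y)); apply: eq_bigr => k _.
by rewrite Xi {2}(coord_basis X_basis (memvf y)) sX.
Qed.

End HyperbolicBasis.

(** * Finite sums of morphisms and n-fold powers *)

Section SumTheory.
Variable D : addCat.
Implicit Types A B C : D.

Lemma comp_suml I (r : seq I) (P : pred I) A B C (g : I -> hom B C) (f : hom A B) :
  (\sum_(i <- r | P i) g i) \oc f = \sum_(i <- r | P i) (g i \oc f).
Proof.
by elim/big_rec2: _ => [|i x y _ <-]; [apply: comp0c | apply: compDl].
Qed.

Lemma comp_sumr I (r : seq I) (P : pred I) A B C (g : hom B C) (f : I -> hom A B) :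
  g \oc (\sum_(i <- r | P i) f i) = \sum_(i <- r | P i) (g \oc f i).
Proof.
by elim/big_rec2: _ => [|i x y _ <-]; [apply: compc0 | apply: compDr].
Qed.

Variables (n : nat) (P : D -> D).
Variables (inj : forall A, 'I_n -> hom A (P A)) (prj : forall A, 'I_n -> hom (P A) A).

(** [P A] is an n-fold biproduct of [A]. The transfer uses only this, so the bracketing of the power
    can be chosen later. *)
Definition power_axiom :=
  (forall A i j, prj A i \oc inj A j = if i == j then idc A else 0) /\
  (forall A, \sum_i inj A i \oc prj A i = idc (P A)).

End SumTheory.

Lemma star_sum (D : hermCat) I (r : seq I) (P : pred I) (A B : D) (f : I -> hom A B) :
  star (\sum_(i <- r | P i) f i) = \sum_(i <- r | P i) star (f i).
Proof.
by elim/big_rec2: _ => [|i x y _ <-]; [apply: star0 | apply: starD].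
Qed.

(** * The transfer functor from C_L to C *)

Section Transfer.
Variables (K : fieldType) (L : fieldExtType K) (C : linHermCat K) (n : nat).
Variables (s : {scalar L}) (b : 'I_n -> L) (t : 'I_n -> 'I_n).
Hypotheses (tK : involutive t)
  (b_gram : forall i j, s (b i * b j) = (j == t i)%:R)
  (b_span : forall y, y = \sum_k s (b (t k) * y) *: b k).
Variables (P : C -> C) (inj : forall A, 'I_n -> hom A (P A))
  (prj : forall A, 'I_n -> hom (P A) A).
Hypothesis P_power : power_axiom inj prj.
Implicit Types A B : C.

Let prj_inj A i j : prj A i \oc inj A j = if i == j then idc A else 0.
Proof. by case: P_power. Qed.
Let inj_prj A : \sum_i inj A i \oc prj A i = idc (P A).
Proof. by case: P_power. Qed.

Lemma kscale0 A B (f : hom A B) : kscale 0 f = 0 :> hom A B.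
Proof. exact: (scale0r (f : khom A B)). Qed.

Lemma kscale_sum A B (f : hom A B) (k : 'I_n -> K) :
  kscale (\sum_i k i) f = \sum_i kscale (k i) f.
Proof. exact: (scaler_suml (f : khom A B)). Qed.

(* The matrix of multiplication by [a] in the basis [b], whose dual basis for *)
(* the form (x, y) |-> s (x y) is [b \o t].                                   *)
Definition mulcoef (a : L) i j : K := s (b (t i) * a * b j).

Lemma mulcoef1 i j : mulcoef 1 i j = (i == j)%:R.
Proof. by rewrite /mulcoef mulr1 b_gram tK eq_sym. Qed.

Lemma mulcoefM a a' i j : mulcoef (a * a') i j = \sum_k mulcoef a i k * mulcoef a' k j.
Proof.
rewrite /mulcoef mulrA -mulrA {1}(b_span (a' * b j)) mulr_sumr linear_sum.
by apply: eq_bigr => k _; rewrite -scalerAr linearZ /= mulrC !mulrA.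
Qed.

(** Multiplication by [a] is self-adjoint for s (x y), L being commutative. This gives the
    naturality of [transfer_delta]. *)
Lemma mulcoef_sym a i j : mulcoef a (t i) (t j) = mulcoef a j i.
Proof. by rewrite /mulcoef tK mulrC (mulrC (b i)) mulrA. Qed.

Definition transfer_tens A B (f : khom A B) (a : L) : hom (P A) (P B) :=
  \sum_i \sum_j inj B i \oc kscale (mulcoef a i j) f \oc prj A j.

Lemma balanced_transfer A B : balanced (@transfer_tens A B).
Proof.
split=> [a f g|f a a'|k f a]; rewrite /transfer_tens -?big_split;
  apply: eq_bigr => i _; rewrite -?big_split; apply: eq_bigr => j _ /=.
- by rewrite kscaleDr compDr compDl.
- rewrite /mulcoef mulrDr mulrDl raddfD /=.
  by rewrite kscaleDl compDr compDl.
- rewrite /mulcoef -scalerAr -scalerAl linearZ /=.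
  by rewrite [k *: f]/(kscale k f) kscaleA mulrC.
Qed.

Definition transfer_hom A B : ext_hom L A B -> hom (P A) (P B) :=
  tensor_lift (@transfer_tens A B).

Lemma transfer_homE A B (f : hom A B) a :
  transfer_hom (etens f a) = transfer_tens f a.
Proof. exact/tensor_liftE/balanced_transfer. Qed.

Lemma transfer_homB A B (x y : ext_hom L A B) :
  transfer_hom (x - y) = transfer_hom x - transfer_hom y.
Proof. exact/tensor_liftB/balanced_transfer. Qed.

Lemma transfer_hom_tens1 A B (f : hom A B) :
  transfer_hom (etens f 1) = \sum_i inj B i \oc f \oc prj A i.
Proof.
rewrite transfer_homE; apply: eq_bigr => i _.
rewrite (bigD1 i) //= big1 ?addr0 => [|j ji].
  by rewrite mulcoef1 eqxx kscale1.
by rewrite mulcoef1 eq_sym (negPf ji) kscale0 compc0 comp0c.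
Qed.

Lemma prj_transfer A B (f : hom A B) a i :
  prj B i \oc transfer_tens f a = \sum_j kscale (mulcoef a i j) f \oc prj A j.
Proof.
rewrite comp_sumr (bigD1 i) //= [X in _ + X]big1 => [|j ji]; last first.
  rewrite comp_sumr big1 // => k _.
  by rewrite !compA prj_inj eq_sym (negPf ji) !comp0c.
rewrite addr0 comp_sumr; apply: eq_bigr => j _.
by rewrite !compA prj_inj eqxx comp1c.
Qed.

Definition transfer_delta A : hom (P (dual A)) (dual (P A)) :=
  \sum_k star (prj A (t k)) \oc prj (dual A) k.

Lemma transfer_delta_iso A : is_iso (transfer_delta A).
Proof.
exists (\sum_k inj (dual A) k \oc star (inj A (t k))); split.
  rewrite comp_suml -[RHS]inj_prj; apply: eq_bigr => k _.
  rewrite /transfer_delta comp_sumr (bigD1 k) //= big1 ?addr0 => [|j jk].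
    by rewrite compA -(compA (inj _ _)) -starM prj_inj eqxx star1 compc1.
  rewrite compA -(compA (inj _ _)) -starM prj_inj (can_eq tK) (negPf jk).
  by rewrite star0 compc0 comp0c.
rewrite /transfer_delta comp_suml -star1 -inj_prj star_sum.
rewrite [RHS](reindex t) /=; last by exists t => ? _.
apply: eq_bigr => k _.
rewrite comp_sumr (bigD1 k) //= big1 ?addr0 => [|j jk].
  by rewrite compA -(compA (star _)) prj_inj eqxx compc1 starM.
by rewrite compA -(compA (star _)) prj_inj eq_sym (negPf jk) compc0 comp0c.
Qed.

Lemma transfer_delta_nat A B (x : ext_hom L A B) :
  transfer_delta A \oc transfer_hom (ext_star x) =
  star (transfer_hom x) \oc transfer_delta B.
Proof.
elim/tensor_ind: x => [f a|x y hx hy]; last first.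
  by rewrite ext_starB !transfer_homB starB compBl compBr hx hy.
rewrite -/(etens _ _) ext_starE !transfer_homE.
transitivity (\sum_i \sum_j
    star (prj A (t i)) \oc kscale (mulcoef a i j) (star f) \oc prj (dual B) j).
  rewrite comp_suml; apply: eq_bigr => i _.
  rewrite -compA prj_transfer comp_sumr; apply: eq_bigr => j _.
  by rewrite compA.
rewrite exchange_big /= comp_sumr; apply: eq_bigr => j _.
rewrite compA -starM prj_transfer star_sum comp_suml.
rewrite [RHS](reindex t) /=; last by exists t => ? _.
apply: eq_bigr => i _; rewrite starM kscale_star.
by rewrite mulcoef_sym.
Qed.

Definition transfer : hermFunctor (ext_cat L C) C.
Proof.
refine (@HermFunctor (ext_cat L C) C P transfer_hom _ _ _ transfer_delta
  transfer_delta_iso _ _).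
- by move=> A B x y; apply: (@morphB_D _ _ _ (@transfer_homB A B)).
- move=> A; rewrite -inj_prj [LHS]transfer_hom_tens1.
  by apply: eq_bigr => i _; rewrite compc1.
- move=> A B A' y x.
  elim/tensor_ind: y => [g a|y y' hy hy']; last first.
    rewrite [_ \oc x]ext_compBl !transfer_homB [RHS]compBl.
    by congr (_ - _); [apply: hy | apply: hy'].
  elim/tensor_ind: x => [f a'|x x' hx hx']; last first.
    rewrite [X in transfer_hom X]ext_compBr !transfer_homB [RHS]compBr.
    by congr (_ - _); [apply: hx | apply: hx'].
  rewrite -!/(etens _ _) [X in transfer_hom X]ext_compE !transfer_homE.
  rewrite [RHS]comp_suml; apply: eq_bigr => i _.
  rewrite comp_suml.
  under [RHS]eq_bigr => k _ do rewrite -compA prj_transfer comp_sumr.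
  rewrite exchange_big /=; apply: eq_bigr => j _.
  rewrite mulcoefM kscale_sum comp_sumr comp_suml; apply: eq_bigr => k _.
  rewrite !compA; congr (_ \oc _); rewrite -!compA; congr (_ \oc _).
  by rewrite kscale_compl kscale_compr kscaleA.
- exact: transfer_delta_nat.
(* Compatibility with [omega] is the symmetry of the Gram matrix, that is, [tK]. *)
- move=> A /=; rewrite transfer_hom_tens1 /transfer_delta star_sum comp_suml.
  rewrite comp_suml [RHS](reindex t) /=; last by exists t => ? _.
  apply: eq_bigr => k _; rewrite tK starM -!compA -omega_nat; congr (_ \oc _).
  rewrite comp_sumr (bigD1 k) //= big1 ?addr0 => [|j jk].
    by rewrite !compA prj_inj eqxx comp1c.
  by rewrite !compA prj_inj eq_sym (negPf jk) !comp0c.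
Defined.

(** On morphisms f tensor 1 the transfer is diagonal, so only [transfer_delta] permutes indices. *)
Lemma transfer_formE (x : sesq C) :
  smor (hf_form transfer (hf_form (ext_functor L C) x)) =
  \sum_k star (prj x (t k)) \oc smor x \oc prj x k.
Proof.
change (transfer_delta x \oc transfer_hom
  (idc (dual x : ext_cat L C) \oc (etens (smor x) 1 : @hom (ext_cat L C) _ _)) =
  \sum_k star (prj x (t k)) \oc smor x \oc prj x k).
rewrite comp1c transfer_hom_tens1 /transfer_delta comp_suml.
apply: eq_bigr => k _; rewrite -!compA; congr (_ \oc _).
rewrite comp_sumr (bigD1 k) //= big1 ?addr0 => [|j jk].
  by rewrite !compA prj_inj eqxx comp1c.
by rewrite !compA prj_inj eq_sym (negPf jk) !comp0c.
Qed.

End Transfer.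

(** * Extension of a hermitian functor to the pseudo-abelian closure *)

Section KaroubiExtension.
Variables (D C : hermCat) (F : hermFunctor D C) (C_pa : pseudo_abelian C).
Implicit Types X Y : karoubi D.

Record splitting (X : karoubi D) := Splitting {
  spl_ob : C;
  spl_in : hom spl_ob (F (kob X));
  spl_out : hom (F (kob X)) spl_ob;
  spl_outK : spl_out \oc spl_in = idc spl_ob;
  spl_inK : spl_in \oc spl_out = hfhom F (kidem X)
}.

Fact splitting_exists X : exists _ : splitting X, True.
Proof.
have ee : hfhom F (kidem X) \oc hfhom F (kidem X) = hfhom F (kidem X).
  by rewrite -hfM kidemP.
by have [M [i [j [ji ij]]]] := C_pa ee; exists (Splitting ji ij).
Qed.

(** Splittings merely exist, so one is chosen for every object. *)
Let spl X : splitting X := projT1 (cid (splitting_exists X)).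
Let G X : C := spl_ob (spl X).
Let i X : hom (G X) (F (kob X)) := spl_in (spl X).
Let j X : hom (F (kob X)) (G X) := spl_out (spl X).

Let ji X : j X \oc i X = idc (G X). Proof. exact: spl_outK. Qed.
Let ij X : i X \oc j X = hfhom F (kidem X). Proof. exact: spl_inK. Qed.
Let ei X : hfhom F (kidem X) \oc i X = i X.
Proof. by rewrite -ij -compA ji compc1. Qed.
Let je X : j X \oc hfhom F (kidem X) = j X.
Proof. by rewrite -ij compA ji comp1c. Qed.

Definition kar_ext_hom X Y (f : hom X Y) : hom (G X) (G Y) :=
  j Y \oc hfhom F (val f) \oc i X.

Definition kar_ext_delta X : hom (G (dual X)) (dual (G X)) :=
  star (i X) \oc hfdelta F (kob X) \oc i (dual X).

(** The idempotent [i \oc j] of the dual passes through [hfdelta] by naturality and is absorbed by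
    [star (i X)]. *)
Lemma kar_ext_delta_hom X A (f : hom A (dual (kob X))) :
  kar_ext_delta X \oc j (dual X) \oc hfhom F f =
  star (i X) \oc hfdelta F (kob X) \oc hfhom F f.
Proof.
rewrite /kar_ext_delta -(compA _ (i _)) ij /= -(compA (star (i X))) hfdelta_nat.
by rewrite compA -starM ei.
Qed.

Lemma kar_ext_delta_iso X : is_iso (kar_ext_delta X).
Proof.
have [d [dE Ed]] := hfdelta_iso F (kob X).
exists (j (dual X) \oc d \oc star (j X)); split.
  rewrite /kar_ext_delta !compA -(compA _ (star (j X))) -starM ij.
  rewrite -(compA _ (star _)) -hfdelta_nat compA -(compA _ d) dE compc1.
  by rewrite (je (dual X)) ji.
have := @kar_ext_delta_hom X _ (idc _).
rewrite hf1 !compc1 => h; rewrite !compA h -(compA _ _ d) Ed compc1.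
by rewrite -starM ji star1.
Qed.

Definition kar_ext : hermFunctor (karoubi D) C.
Proof.
refine (@HermFunctor (karoubi D) C G kar_ext_hom _ _ _ kar_ext_delta
  kar_ext_delta_iso _ _).
- by move=> X Y f g; rewrite /kar_ext_hom hfD compDr compDl.
- by move=> X; rewrite /kar_ext_hom je ji.
- move=> X Y Z g f; rewrite /kar_ext_hom hfM !compA.
  by rewrite -(compA _ (i Y)) ij -(compA _ _ (hfhom F (kidem Y))) -hfM kar_homr.
- move=> X Y f; rewrite {1}/kar_ext_hom !compA kar_ext_delta_hom.
  rewrite -(compA (star (i X))) hfdelta_nat /kar_ext_hom /kar_ext_delta !compA.
  by rewrite -!starM !compA ij -hfM kar_homl.
- move=> X.
  have wE : val (omega X) = omega (kob X) \oc kidem X.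
    change (star (star (kidem X)) \oc omega _ \oc kidem X = omega _ \oc kidem X).
    by rewrite -omega_nat -compA kidemP.
  rewrite {1}/kar_ext_hom !compA kar_ext_delta_hom wE /kar_ext_delta !starM.
  rewrite hfM -!compA ei -omega_nat; congr (_ \oc _).
  by rewrite !compA -hfdelta_omega.
Defined.

(** The splitting chosen for an identity need not be trivial, but its [i] is an isomorphism, and
    this is the isometry. *)
Lemma kar_ext_form (x : sesq D) :
  isometric (hf_form kar_ext (hf_form (kar_incl D) x)) (hf_form F x).
Proof.
pose X : karoubi D := kar_incl_ob (sob x); exists (i X); split.
  by exists (j X); split; [exact: ji | exact: etrans (ij X) (hf1 F _)].
change (kar_ext_delta X \oc (j (dual X) \oc
    hfhom F (idc (dual (sob x)) \oc smor x) \oc i X) =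
  star (i X) \oc (hfdelta F (sob x) \oc hfhom F (smor x)) \oc i X).
by rewrite comp1c !compA kar_ext_delta_hom.
Qed.

End KaroubiExtension.

(** * The power A^(2m+1) *)

Section HyperbolicPower.
Variables (D : addCat) (A : D).

(** Bracketed so that the transferred form is an iterated orthogonal sum with planes [hplane x]. *)
Fixpoint hpow m : D := if m is m'.+1 then bip (hpow m') (bip A A) else A.

(** Values at k > 2m are junk; natural indices avoid casts between ordinals. *)
Fixpoint hinj m (k : nat) : hom A (hpow m) :=
  if m is m'.+1 then
    if (k < m'.*2.+1)%N then injl \oc hinj m' k
    else injr \oc (if k == m'.*2.+1 then injl else injr)
  else idc A.

Fixpoint hprj m (k : nat) : hom (hpow m) A :=
  if m is m'.+1 then
    if (k < m'.*2.+1)%N then hprj m' k \oc prjl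
    else (if k == m'.*2.+1 then prjl else prjr) \oc prjr
  else idc A.

Lemma hprj_inj m i j : (i < m.*2.+1)%N -> (j < m.*2.+1)%N ->
  hprj m i \oc hinj m j = if i == j then idc A else 0.
Proof.
elim: m i j => [|m IHm] i j.
  by rewrite !ltnS !leqn0 => /eqP-> /eqP->; rewrite /= comp1c.
rewrite doubleS => im jm /=.
have [i_lt|i_ge] := ltnP i; have [j_lt|j_ge] := ltnP j.
- by rewrite compA -(compA _ prjl) prjl_injl compc1 IHm.
- rewrite compA -(compA _ prjl) prjl_injr compc0 comp0c.
  by rewrite ltn_eqF // (leq_trans i_lt).
- rewrite compA -(compA _ prjr) prjr_injl compc0 comp0c.
  by rewrite gtn_eqF // (leq_trans j_lt).
- rewrite compA -(compA _ prjr) prjr_injr compc1.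
  have iE : i = m.*2.+1 \/ i = m.*2.+2.
    move: i_ge; rewrite leq_eqVlt => /predU1P[|h]; first by left.
    by right; apply/eqP; rewrite eqn_leq -ltnS im.
  have jE : j = m.*2.+1 \/ j = m.*2.+2.
    move: j_ge; rewrite leq_eqVlt => /predU1P[|h]; first by left.
    by right; apply/eqP; rewrite eqn_leq -ltnS jm.
  case: iE jE => -> [] ->; rewrite ?eqxx ?(gtn_eqF (ltnSn _)) ?(ltn_eqF (ltnSn _)).
  + exact: prjl_injl.
  + exact: prjl_injr.
  + exact: prjr_injl.
  + exact: prjr_injr.
Qed.

Lemma hinj_prj m : \sum_(k < m.*2.+1) hinj m k \oc hprj m k = idc (hpow m).
Proof.
elim: m => [|m IHm]; first by rewrite big_ord1 comp1c.
rewrite doubleS 2!big_ord_recr /= ltnn ltnNge leqnSn /= eqxx gtn_eqF //.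
rewrite -[RHS]bip_id -[X in _ = X \oc _ + _]compc1 -IHm comp_sumr comp_suml.
rewrite -addrA; congr (_ + _).
  by apply: eq_bigr => k _; rewrite ltn_ord !compA.
by rewrite !compA -compDl -!(compA injr) -compDr bip_id compc1.
Qed.

End HyperbolicPower.

(** * Hyperbolic planes over a form vanish in the Witt groups *)

Section HyperbolicSummands.
Variable C : hermCat.
Implicit Types x : sesq C.

Definition hplane_mor (A B : C) (f : hom A (dual B)) :
  hom (bip A A) (dual (bip B B)) :=
  star prjl \oc f \oc prjr + star prjr \oc f \oc prjl.

(* The tensor product of the form [x] with a hyperbolic plane.                *)
Definition hplane (x : sesq C) : sesq C := @Sesq C (bip x x) (hplane_mor (smor x)).

Fixpoint hform_mor (x : sesq C) m : hom (hpow x m) (dual (hpow x m)) :=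
  if m is m'.+1 then dsum (hform_mor x m') (hplane_mor (smor x)) else smor x.

Definition hform x m : sesq C := @Sesq C (hpow x m) (hform_mor x m).

Lemma hform_morE x m : hform_mor x m =
  \sum_(k < m.*2.+1) star (hprj x m (hswap k)) \oc smor x \oc hprj x m k.
Proof.
elim: m => [|m IHm]; first by rewrite big_ord1 /= star1 comp1c compc1.
rewrite doubleS 2!big_ord_recr.
have -> : hswap m.*2.+1 = m.*2.+2 by rewrite /hswap /= odd_double.
have -> : hswap m.*2.+2 = m.*2.+1 by rewrite /hswap /= odd_double.
rewrite /= ltnn ltnNge leqnSn /= eqxx gtn_eqF // /dsum IHm -addrA; congr (_ + _).
  rewrite comp_sumr comp_suml; apply: eq_bigr => k _.
  by rewrite ltn_ord hswap_lt // starM !compA.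
by rewrite /hplane_mor compDr compDl !starM !compA addrC.
Qed.

Definition bip_swap (A : C) : hom (bip A A) (bip A A) :=
  injl \oc prjr + injr \oc prjl.

Lemma prjl_swap A : prjl \oc bip_swap A = prjr.
Proof. by rewrite compDr !compA prjl_injl prjl_injr comp1c comp0c addr0. Qed.

Lemma prjr_swap A : prjr \oc bip_swap A = prjl.
Proof. by rewrite compDr !compA prjr_injl prjr_injr comp1c comp0c add0r. Qed.

Lemma bip_swapK A : bip_swap A \oc bip_swap A = idc (bip A A).
Proof.
by rewrite {1}/bip_swap compDl -!compA prjl_swap prjr_swap bip_id.
Qed.

Lemma dsum_swap A B (f : hom A (dual B)) : dsum f f \oc bip_swap A = hplane_mor f.
Proof. by rewrite /dsum compDl -!compA prjl_swap prjr_swap !compA. Qed.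

Lemma star_swap_dsum A B (f : hom A (dual B)) :
  star (bip_swap B) \oc dsum f f = hplane_mor f.
Proof.
by rewrite /dsum compDr !compA -!starM prjl_swap prjr_swap addrC.
Qed.

Lemma star_swap_hplane A B (f : hom A (dual B)) :
  star (bip_swap B) \oc hplane_mor f = dsum f f.
Proof. by rewrite -star_swap_dsum compA -starM bip_swapK star1 comp1c. Qed.

Lemma hplane_mor_iso (A : C) (f : hom A (dual A)) : is_iso f -> is_iso (hplane_mor f).
Proof.
move=> fi; rewrite -dsum_swap; apply: is_iso_comp; first exact: is_iso_dsum.
by exists (bip_swap A); rewrite bip_swapK.
Qed.

Lemma hplane_adj (A B : C) (f : hom A (dual B)) :
  star (hplane_mor f) \oc omega (bip B B) = hplane_mor (star f \oc omega B).
Proof.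
rewrite /hplane_mor starD !starM compDl addrC -!compA.
by congr (_ + _); rewrite -omega_nat.
Qed.

Lemma hplane_unimodular x : unimodular x -> unimodular (hplane x).
Proof.
by case=> xl xr; split; rewrite ?[omega _]/(omega (bip x x)) ?hplane_adj;
  apply: hplane_mor_iso.
Qed.

Lemma hplane_eherm eps x : eherm eps x -> eherm eps (hplane x).
Proof.
move=> xE; rewrite /eherm hplane_adj /= /hplane_mor {1 2}xE.
by rewrite !compMzr !compMzl -mulrzDl.
Qed.

Definition uhplane eps (x : uform C eps) : uform C eps :=
  UForm (hplane_unimodular (uformU x)) (hplane_eherm (uformE x)).

(** Applying the form itself to the second summand carries x + x to x + x^*, and the matrix (0, s;
    s, 0) to (0, 1; eps omega, 0), because s is eps-hermitian. *)
Lemma uhplane_hyperbolic eps (x : uform C eps) : uhyperbolic (uhplane x).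
Proof.
have [xl xr] := uformU x; exists (sob x); split.
  rewrite /reflexive_ob; have [g [gs sg]] := is_iso_star xl.
  have -> : omega x = g \oc (star (smor x) \oc omega x) by rewrite compA gs comp1c.
  by apply: is_iso_comp => //; exists (star (smor x)).
have [s' [s's ss']] := xl.
pose u : hom (bip x x) (bip x (dual x)) := injl \oc prjl + injr \oc smor x \oc prjr.
have lu : prjl \oc u = prjl.
  by rewrite /u compDr !compA prjl_injl prjl_injr !comp0c comp1c addr0.
have ru : prjr \oc u = smor x \oc prjr.
  by rewrite /u compDr !compA prjr_injl prjr_injr !comp0c comp1c add0r.
exists u; split.
  pose v : hom (bip x (dual x)) (bip x x) := injl \oc prjl + injr \oc s' \oc prjr.
  have lv : prjl \oc v = prjl.
    by rewrite /v compDr !compA prjl_injl prjl_injr !comp0c comp1c addr0.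
  have rv : prjr \oc v = s' \oc prjr.
    by rewrite /v compDr !compA prjr_injl prjr_injr !comp0c comp1c add0r.
  exists v; split.
    by rewrite compDl -!compA lu ru (compA s') s's comp1c bip_id.
  by rewrite compDl -!compA lv rv (compA (smor x)) ss' comp1c bip_id.
rewrite /= compDr compDl !compA -!starM -!(compA _ _ u) lu ru compc1 starM.
have xE : smor x = (star (smor x) \oc omega x) *~ eps := uformE x.
rewrite /hplane_mor [X in _ + star prjr \oc X \oc _ = _]xE.
by rewrite !compMzr !compMzl !compA.
Qed.

(** [hform x m] carries no proof that it is unimodular and eps-hermitian, hence the lift [h]. *)
Lemma Wclass_hform eps (x : uform C eps) m :
  exists2 h : uform C eps, uform_sesq h = hform x m & Wclass h = Wclass x.
Proof.
elim: m => [|m [h hE hx]]; first by exists x => //; case: (uform_sesq x).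
exists (uorth h (uhplane x)); first by rewrite /= hE.
rewrite [LHS]witt_class_op -/(Wclass h) hx.
by rewrite [X in _ + X]witt_class_eq0 ?addr0 //; apply: uhplane_hyperbolic.
Qed.

Lemma ar2_reflexive (X : Ar2 C) : reflexive_ob X.
Proof.
have hf : ar2f X \oc idc (ar2M X) =
    star (idc (ar2N X)) \oc ar2f (ar2_dual (ar2_dual X)).
  by rewrite /= star_omega_star star1 comp1c compc1.
have hg : ar2g X \oc idc (ar2M X) =
    star (idc (ar2N X)) \oc ar2g (ar2_dual (ar2_dual X)).
  by rewrite /= star_omega_star star1 comp1c compc1.
exists (@ar2_mor C (ar2_dual (ar2_dual X)) X (idc _) (idc _) hf hg).
by split; apply: ar2_homP; apply: comp1c.
Qed.

(* With X the object of F(M, s), the object of F applied to the hyperbolic    *)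
(* plane over (M, s) is isomorphic to X + X^* by the pair (id, swap).         *)
Lemma hplane_sesq_hyperbolic x : sesq_hyperbolic (hplane x).
Proof.
pose X : Ar2 C := sob (ar2_form x); exists X; split; first exact: ar2_reflexive.
pose Y : Ar2 C := sob (ar2_form (hplane x)); pose Z : Ar2 C := sob (hyp_form 1 X).
have fY : ar2f Y = hplane_mor (star (smor x) \oc omega x) by apply: hplane_adj.
have gY : ar2g Y = hplane_mor (smor x) by [].
have fZ : ar2f Z = dsum (star (smor x) \oc omega x) (star (smor x) \oc omega x) by [].
have gZ : ar2g Z = dsum (smor x) (smor x).
  rewrite -[X in _ = dsum _ X]star_omega_star; reflexivity.
have hf : ar2f Z \oc idc (bip x x) = star (bip_swap x) \oc ar2f Y.
  by rewrite fY fZ star_swap_hplane compc1.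
have hg : ar2g Z \oc idc (bip x x) = star (bip_swap x) \oc ar2g Y.
  by rewrite gY gZ star_swap_hplane compc1.
have hf' : ar2f Y \oc idc (bip x x) = star (bip_swap x) \oc ar2f Z.
  by rewrite fY fZ star_swap_dsum compc1.
have hg' : ar2g Y \oc idc (bip x x) = star (bip_swap x) \oc ar2g Z.
  by rewrite gY gZ star_swap_dsum compc1.
pose u : @hom (Ar2 C) Y Z := @ar2_mor C Y Z (idc (bip x x)) (bip_swap x) hf hg.
pose u' : @hom (Ar2 C) Z Y := @ar2_mor C Z Y (idc (bip x x)) (bip_swap x) hf' hg'.
exists u; split.
  by exists u'; split; apply: ar2_homP; (exact: comp1c || exact: bip_swapK).
(* Both components of the hyperbolic form are swaps; the swap in [u] cancels them. *)
rewrite /hyp_form /= mulr1z; apply: ar2_homP.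
- change (idc (bip x x) = bip_swap x \oc (injl \oc idc (sob x) \oc prjr +
    injr \oc idc (sob x) \oc prjl) \oc idc (bip x x)).
  by rewrite !compc1 bip_swapK.
- change (idc (bip x x) = bip_swap x \oc ((injr \oc (idc (sob x) \oc prjl) +
    injl \oc (idc (sob x) \oc prjr)) \oc idc (bip x x))).
  by rewrite !comp1c compc1 addrC bip_swapK.
Qed.

Lemma WSclass_hform x m : WSclass (hform x m) = WSclass x.
Proof.
elim: m => [|m IHm]; first by case: x.
rewrite -[RHS]IHm [LHS](@witt_class_op _ _ _ _ (hform x m) (hplane x)).
rewrite [X in _ + X]witt_class_eq0 ?addr0 //; exact: hplane_sesq_hyperbolic.
Qed.

End HyperbolicSummands.

(** * The transfer as a left inverse of scalar extension *)

Lemma hf_form_comp (C D E : hermCat) (G : hermFunctor D E) (F : hermFunctor C D)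
    (x : sesq C) : hf_form (hf_comp G F) x = hf_form G (hf_form F x).
Proof. by congr Sesq; rewrite /= hfM compA. Qed.

Lemma Wmap_cancel (C D : hermCat) (R : hermFunctor C D) (T : hermFunctor D C) eps :
  (forall x : uform C eps, Wclass (hf_uform T (hf_uform R x)) = Wclass x) ->
  cancel (Wmap R eps) (Wmap T eps).
Proof.
move=> TR; apply: witt_ind => [|x|x y hx hy]; last by rewrite !WmapB hx hy.
  by rewrite -(subrr 0) !WmapB !subrr.
by rewrite -/(Wclass x) !WmapE.
Qed.

Lemma WSmap_cancel (C D : hermCat) (R : hermFunctor C D) (T : hermFunctor D C) :
  (forall x : sesq C, WSclass (hf_form T (hf_form R x)) = WSclass x) ->
  cancel (WSmap R) (WSmap T).
Proof.
move=> TR; apply: witt_ind => [|x|x y hx hy]; last by rewrite !WSmapB hx hy.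
  by rewrite -(subrr 0) !WSmapB !subrr.
by rewrite -/(WSclass x) !WSmapE.
Qed.

Lemma transfer_scalar_ext (K : fieldType) (L : fieldExtType K) (C : linHermCat K) :
  odd (\dim {:L}) -> 2%N \notin [pchar K] -> pseudo_abelian C ->
  exists (m : nat) (T : hermFunctor (karoubi (ext_cat L C)) C),
    forall x : sesq C, isometric (hf_form T (hf_form (scalar_ext L C) x)) (hform x m).
Proof.
move=> L_odd K_char C_pa.
have [m [s [b [b_gram b_span]]]] := hyperbolic_basis L_odd K_char.
pose t (k : 'I_m.*2.+1) := Ordinal (hswap_lt (ltn_ord k)).
have tK : involutive t by move=> k; apply/val_inj/hswapK.
have P_power : power_axiom (n := m.*2.+1) (P := fun A : C => hpow A m)
    (fun A k => hinj A m k) (fun A k => hprj A m k).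
  by split=> A; [move=> i j; apply: hprj_inj | apply: hinj_prj].
have gram (i j : 'I_m.*2.+1) : s (b i * b j) = (j == t i)%:R by apply: b_gram.
exists m, (kar_ext (transfer tK gram b_span P_power) C_pa) => x.
rewrite /scalar_ext hf_form_comp; apply: isometric_trans (kar_ext_form _ _ _) _.
suff -> : hform x m =
    hf_form (transfer tK gram b_span P_power) (hf_form (ext_functor L C) x).
  by exists (idc _); split; [apply: is_iso1 | rewrite star1 comp1c compc1].
have e := etrans (hform_morE x m) (esym (transfer_formE tK gram b_span P_power x)).
by refine (congr1 (@Sesq C (hpow x m)) e).
Qed.

Theorem theorem5p18 (K : fieldType) (L : fieldExtType K)
    (L_odd : odd (\dim {:L})) (K_char : 2%N \notin [pchar K])
    (eps : int) (eps_sign : eps = 1 \/ eps = -1)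
    (C : linHermCat K) (C_pa : pseudo_abelian C)
    (C_fin : forall M M' : C, finite_dim (khom M M')) :
  injective (Wmap (scalar_ext L C) eps) /\ injective (WSmap (scalar_ext L C)).
Proof.
have [m [T TR]] := transfer_scalar_ext L_odd K_char C_pa.
split; [apply: (can_inj (@Wmap_cancel _ _ _ T _ _)) => x|
        apply: (can_inj (@WSmap_cancel _ _ _ T _)) => x].
  have [h hE <-] := Wclass_hform x m; apply: witt_class_iso.
  by rewrite /uisometric hE; apply: TR.
by rewrite -[RHS](WSclass_hform x m); apply: witt_class_iso.
Qed.
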